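(* Let $K$ be a field of characteristic zero, $x=(x_1,\dots,x_n)$, and $H\in K[x]^M$ with $\operatorname{trdeg}_K K(H)=M-2$. Let $0\le s<k<M$ and suppose $(H_{s+1},H_{s+2},\dots,H_k)$ has no projective image apex over $K$ in $K^{k-s}$. Suppose additionally that either (i) $(H_{k+1},\dots,H_M)$ has no projective image apex over $K$ in $K^{M-k}$; or (ii) $(H_k,H_{k+1},\dots,H_M)$ has no projective image apex over $K$ in $K^{M-k+1}$ and $H$ has an image apex over $K$ in $K^M$. Let $h=(H_1,\dots,H_s,\,H_{s+1}+H_M,\,H_{s+2},\dots,H_{M-1})\in K[x]^{M-1}$. Then the projective image apices over $K$ in $K^M$ of $H$ are exactly the nonzero vectors in the span of $e_1,\dots,e_s$, and likewise the projective image apices over $K$ in $K^{M-1}$ of $h$ are exactly the nonzero vectors in the span of $e_1,\dots,e_s$. Furthermore, $h$ and $H$ are dB-paired over $K$ (through $B$ with $h=BH$ and $C=I_n$), and every projective image apex of $h$ is inherited from $H$.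
   Context: $e_i$ is the $i$-th standard basis vector. With $y$ a tuple of indeterminates and $t$ a new one: $a\in K^M$ is an image apex of $H$ over $K$ if for all $f\in K[y]$, $f(H)=0\Rightarrow f((1-t)H+ta)=0$; $p\in K^M$ is a projective image apex of $H$ over $K$ if $p\ne0$ and $f(H)=0\Rightarrow f(H+tp)=0$ for all $f\in K[y]$. $\operatorname{trdeg}_K K(H)$ is the transcendence degree over $K$ of the field generated by the components. dB-pairing: $h\in K[x]^m$ and $H\in K[x]^M$ are dB-paired over $K$ through $B\in\operatorname{Mat}_{m,M}(K)$ and $C\in\operatorname{Mat}_{n,n}(K)$ if $h=B\,H(Cx)$ and $\operatorname{trdeg}_K K(h)=\operatorname{trdeg}_K K(H)$. A projective image apex $q$ of $h$ is inherited from $H$ if $q=BQ$ for some projective image apex $Q$ of $H$ over $K$. *)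

(* Defs.v *)
From HB Require Import structures.
From mathcomp Require Import all_boot all_order all_algebra.
Set Implicit Arguments.
Unset Strict Implicit.
Unset Printing Implicit Defensive.
Import Order.TTheory GRing.Theory Num.Theory.
Local Open Scope ring_scope.

Fixpoint mpoly (K : comNzRingType) (n : nat) : comNzRingType :=
  match n with
  | 0 => K
  | n'.+1 => ({poly mpoly K n'} : comNzRingType)
  end.

Fixpoint mconst (K : comNzRingType) (n : nat) : K -> mpoly K n :=
  match n return K -> mpoly K n with
  | 0 => fun c => c
  | n'.+1 => fun c => (mconst n' c)%:P
  end.

(* the variable with 0-based index i (i.e. x_{i+1}); 0 if i >= n *)
Fixpoint mvar (K : comNzRingType) (n : nat) (i : nat) : mpoly K n :=
  match n return mpoly K n with
  | 0 => 0
  | n'.+1 => if i == n' then 'X else (mvar K n' i)%:P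
  end.

Fixpoint meval (K : comNzRingType) (A : comNzRingType) (c : K -> A) (m : nat)
  : mpoly K m -> (nat -> A) -> A :=
  match m return mpoly K m -> (nat -> A) -> A with
  | 0 => fun f _ => c f
  | m'.+1 => fun f v =>
      \sum_(i < size (f : {poly mpoly K m'})) @meval K A c m' f`_i v * v m' ^+ i
  end.

Definition msubst (K : comNzRingType) (n m : nat) (f : mpoly K m)
  (G : nat -> mpoly K n) : mpoly K n := meval (mconst n) f G.

Definition cvnat (K : comNzRingType) (m : nat) (p : 'cV[K]_m) (i : nat) : K :=
  match (insub i : option 'I_m) with Some j => p j 0 | None => 0 end.

(* K[x][t] = K[x_1..x_n,t] is mpoly K n.+1 with t = 'X. *)

Definition image_apex (K : comNzRingType) (n m : nat) (G : nat -> mpoly K n)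
  (a : 'cV[K]_m) : Prop :=
  forall f : mpoly K m, msubst f G = 0 ->
    msubst (n := n.+1) f
      (fun i => (1 - 'X) * (G i)%:P + 'X * mconst n.+1 (cvnat a i)) = 0.

Definition proj_image_apex (K : comNzRingType) (n m : nat) (G : nat -> mpoly K n)
  (p : 'cV[K]_m) : Prop :=
  p != 0 /\
  forall f : mpoly K m, msubst f G = 0 ->
    msubst (n := n.+1) f (fun i => (G i)%:P + 'X * mconst n.+1 (cvnat p i)) = 0.

Definition alg_indep (K : comNzRingType) (n d : nat) (G : nat -> mpoly K n) : Prop :=
  forall f : mpoly K d, msubst f G = 0 -> f = 0.

Definition subfam (K : comNzRingType) (n m : nat) (G : nat -> mpoly K n)
  (S : {set 'I_m}) : nat -> mpoly K n :=
  fun i => G (nth 0%N [seq val j | j <- enum S] i).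

(* trdeg_K K(G_0..G_{m-1}) = d : the maximal number of algebraically
   independent elements among the generators G_0..G_{m-1} is d *)
Definition is_trdeg (K : comNzRingType) (n m : nat) (G : nat -> mpoly K n)
  (d : nat) : Prop :=
  (exists S : {set 'I_m}, #|S| = d /\ alg_indep #|S| (subfam G S)) /\
  (forall S : {set 'I_m}, alg_indep #|S| (subfam G S) -> (#|S| <= d)%N).

Definition dB_paired (K : comNzRingType) (n m M' : nat)
  (h H : nat -> mpoly K n) (B : 'M[K]_(m, M')) (C : 'M[K]_n) : Prop :=
  (forall i : 'I_m,
     h i = \sum_(j < M') mconst n (B i j) *
             msubst (H j) (fun l => \sum_(r < n) mconst n (match (insub l : option 'I_n) with Some l' => C l' r | None => 0 end) * mvar K n r))
  /\ (exists d, is_trdeg m h d /\ is_trdeg M' H d).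

(* Main.v *)
Require Import Defs.
From HB Require Import structures.
From mathcomp Require Import all_boot all_order all_algebra.
From mathcomp Require Import ring zify.
From Stdlib Require Import Classical.
Import Order.TTheory GRing.Theory Num.Theory.
Set Implicit Arguments.
Unset Strict Implicit.
Unset Printing Implicit Defensive.
Local Open Scope ring_scope.

(** Fix an embedding [iota] of [K[x]] in a field [L]. In characteristic zero the vectors [v] over
    [L] annihilated by the differentials of all relations [f(G) = 0] form the column space of the
    Jacobian of [G] (a tangent vector extends to one more component, hence to all the variables
    [x]); by Taylor's formula the projective image apices are the nonzero constant vectors of that
    space, and transcendence degrees are ranks of Jacobians.

    A block without projective image apex has dependent gradients. As the rank of [H] is [M - 2],
    the relations of [H] are then those of the two blocks, [H_1, ..., H_s] are independent of the
    rest, and the apices of [H] follow. An apex [p] of [h] lifts to a tangent vector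
    [p - lam (e_(s+1) - e_M)] of [H]. A relation of the first block expresses [lam] as a quotient
    [A / B] of elements of its algebra, and a relation of the second block does the same there.
    So [B dA - A dB] lies in the intersection of the spans of the gradients of both blocks. This
    intersection is zero in case (i); in case (ii) it is the line of [dH_k], on which the Euler
    field of the image apex does not vanish, whereas it kills [B dA - A dB]. Hence [A / B] is
    constant, the lift is an apex of [H], and [lam = 0]. *)

(** * Evaluation of iterated polynomials as a ring morphism *)

Section Evaluation.
Variable K : comNzRingType.

Lemma mconst_zmod_morphism n : zmod_morphism (@mconst K n).
Proof. by elim: n => [|n IHn] a b //=; rewrite IHn polyCB. Qed.

Lemma mconst_monoid_morphism n : monoid_morphism (@mconst K n).
Proof.
elim: n => [|n [IH1 IHM]]; first by split.
by split=> [|a b] /=; rewrite ?IH1 ?IHM ?polyCM.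
Qed.

HB.instance Definition _ n :=
  GRing.isZmodMorphism.Build K (mpoly K n) (@mconst K n) (@mconst_zmod_morphism n).
HB.instance Definition _ n :=
  GRing.isMonoidMorphism.Build K (mpoly K n) (@mconst K n) (@mconst_monoid_morphism n).

(** One induction yields both structures: the induction step packs the evaluation at level [m] as a
    ring morphism [phi], after which level [m.+1] is [map_poly phi] followed by [horner]. *)
Lemma meval_rmorphism (A : comNzRingType) (c : {rmorphism K -> A}) m (v : nat -> A) :
  zmod_morphism (fun f => @meval K A c m f v) * monoid_morphism (fun f => @meval K A c m f v).
Proof.
elim: m => [|m [IHB IHM]].
  by split; [exact: rmorphB | split; [exact: rmorph1 | exact: rmorphM]].
pose phi : {rmorphism mpoly K m -> A} := HB.pack (fun f => @meval K A c m f v)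
  (GRing.isZmodMorphism.Build _ _ _ IHB) (GRing.isMonoidMorphism.Build _ _ _ IHM).
have E f : @meval K A c m.+1 f v = (map_poly phi f).[v m].
  rewrite /= (@horner_coef_wide _ (size (f : {poly mpoly K m}))) ?size_poly //.
  by apply: eq_bigr => i _; rewrite coef_poly ltn_ord.
split=> [f g|]; first by rewrite !E rmorphB hornerD hornerN.
by split=> [|f g]; rewrite !E ?rmorph1 ?hornerC // rmorphM hornerM.
Qed.

(** Bundling the coefficient map lets evaluation carry ring morphism instances; [msubst f G] is
    convertible to [mev (@mconst K n) m G f]. *)
Definition mev (A : comNzRingType) (c : {rmorphism K -> A}) m (v : nat -> A) :=
  fun f => @meval K A c m f v.
Arguments mev {A} c m v f.

HB.instance Definition _ (A : comNzRingType) (c : {rmorphism K -> A}) m v :=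
  GRing.isZmodMorphism.Build (mpoly K m) A (mev c m v) (meval_rmorphism c m v).1.
HB.instance Definition _ (A : comNzRingType) (c : {rmorphism K -> A}) m v :=
  GRing.isMonoidMorphism.Build (mpoly K m) A (mev c m v) (meval_rmorphism c m v).2.

Lemma mev_polyE (A : comNzRingType) (c : {rmorphism K -> A}) m v (f : {poly mpoly K m}) :
  mev c m.+1 v f = (map_poly (mev c m v) f).[v m].
Proof.
rewrite (@horner_coef_wide _ (size f)) ?size_poly //.
by apply: eq_bigr => i _; rewrite coef_poly ltn_ord.
Qed.

Lemma mev_const (A : comNzRingType) (c : {rmorphism K -> A}) m v a :
  mev c m v (mconst m a) = c a.
Proof. by elim: m => //= m IHm; rewrite mev_polyE map_polyC hornerC. Qed.

Lemma mev_var (A : comNzRingType) (c : {rmorphism K -> A}) m v i :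
  (i < m)%N -> mev c m v (mvar K m i) = v i.
Proof.
elim: m => //= m IHm; rewrite ltnS leq_eqVlt mev_polyE.
case: eqP => [-> _|_ /= /IHm]; first by rewrite map_polyX hornerX.
by rewrite map_polyC hornerC.
Qed.

Lemma rmorphism_mpoly_ext (A : comNzRingType) m (phi psi : {rmorphism mpoly K m -> A}) :
  (forall c, phi (mconst m c) = psi (mconst m c)) ->
  (forall i, (i < m)%N -> phi (mvar K m i) = psi (mvar K m i)) -> phi =1 psi.
Proof.
elim: m phi psi => [|m IHm] phi psi Ec Ev //= f.
have E := IHm (phi \o polyC) (psi \o polyC).
elim/poly_ind: f => [|p a IHp]; first by rewrite !rmorph0.
have EX : phi 'X = psi 'X by have := Ev m (ltnSn m); rewrite /= eqxx.
rewrite !rmorphD !rmorphM IHp EX; congr (_ + _); apply: E => //= i lt_im.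
by have := Ev i (ltnW lt_im); rewrite /= ltn_eqF.
Qed.

Lemma msubst_mvar n (f : mpoly K n) (v : nat -> mpoly K n) :
  (forall i, (i < n)%N -> v i = mvar K n i) -> msubst f v = f.
Proof.
move=> Ev; apply: (rmorphism_mpoly_ext (phi := mev (@mconst K n) n v) (psi := idfun)) => [c|i lti] /=.
  by rewrite mev_const.
by rewrite mev_var ?Ev.
Qed.

Lemma rmorph_mev (A B : comNzRingType) (c : {rmorphism K -> A}) (c' : {rmorphism K -> B})
    (phi : {rmorphism A -> B}) m v w (f : mpoly K m) :
  (forall a, phi (c a) = c' a) -> (forall i, (i < m)%N -> phi (v i) = w i) ->
  phi (mev c m v f) = mev c' m w f.
Proof.
move=> Ec Ev; pose psi : {rmorphism mpoly K m -> B} := phi \o mev c m v.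
apply: (rmorphism_mpoly_ext (phi := psi) (psi := mev c' m w)) => [a|i lti] /=.
  by rewrite !mev_const.
by rewrite !mev_var ?Ev.
Qed.

End Evaluation.
Arguments mev {K A} c m v f.

(** * Derivations of iterated polynomial rings *)

Section Derivations.

(** Derivations of [A] into [B], seen as an [A]-module through [phi]. Linearity over [K] is imposed
    separately, as vanishing on constants. *)
Definition derivation (A B : comNzRingType) (phi D : A -> B) : Prop :=
  {morph D : a b / a + b} /\ forall a b, D (a * b) = phi a * D b + D a * phi b.

Lemma derivation0 (A B : comNzRingType) (phi D : A -> B) : derivation phi D -> D 0 = 0.
Proof. by case=> DD _; apply: (addIr (D 0)); rewrite -DD !add0r. Qed.

Lemma derivationN (A B : comNzRingType) (phi D : A -> B) a : derivation phi D -> D (- a) = - D a.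
Proof.
by move=> dD; apply: (addIr (D a)); rewrite -dD.1 !addNr (derivation0 dD).
Qed.

Lemma derivationB (A B : comNzRingType) (phi D : A -> B) a b :
  derivation phi D -> D (a - b) = D a - D b.
Proof. by move=> dD; rewrite dD.1 (derivationN _ dD). Qed.

Lemma derivation_sum (A B : comNzRingType) (phi D : A -> B) I (r : seq I) (P : pred I) F :
  derivation phi D -> D (\sum_(i <- r | P i) F i) = \sum_(i <- r | P i) D (F i).
Proof. by move=> dD; apply: (big_morph D dD.1 (derivation0 dD)). Qed.

Lemma derivation_comp (A B C : comNzRingType) (psi : {rmorphism C -> A}) (phi D : A -> B) :
  derivation phi D -> derivation (phi \o psi) (D \o psi).
Proof. by case=> DD DM; split=> a b /=; rewrite ?rmorphD ?rmorphM ?DD ?DM. Qed.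

Lemma derivation_rmorph (A B C : comNzRingType) (psi : {rmorphism B -> C}) (phi D : A -> B) :
  derivation phi D -> derivation (psi \o phi) (psi \o D).
Proof. by case=> DD DM; split=> a b /=; rewrite ?DD ?DM ?rmorphD ?rmorphM. Qed.

Lemma derivation_comb (A B : comNzRingType) (phi : A -> B) (I : finType) (w : I -> B) (D : I -> A -> B) :
  (forall i, derivation phi (D i)) -> derivation phi (fun a => \sum_i w i * D i a).
Proof.
move=> dD; split=> a b.
  by rewrite -big_split; apply: eq_bigr => i _; rewrite (dD i).1 mulrDr.
rewrite mulr_sumr mulr_suml -big_split; apply: eq_bigr => i _ /=.
by rewrite (dD i).2; ring.
Qed.

Lemma derivation_mpoly_ext (K B : comNzRingType) m (phi : {rmorphism mpoly K m -> B}) D1 D2 :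
  derivation phi D1 -> derivation phi D2 ->
  (forall c, D1 (mconst m c) = D2 (mconst m c)) ->
  (forall i, (i < m)%N -> D1 (mvar K m i) = D2 (mvar K m i)) -> D1 =1 D2.
Proof.
elim: m phi D1 D2 => [|m IHm] phi D1 D2 d1 d2 Ec Ev //= f.
have E := IHm (phi \o polyC) (D1 \o polyC) (D2 \o polyC) (derivation_comp _ d1) (derivation_comp _ d2).
elim/poly_ind: f => [|p a IHp]; first by rewrite (derivation0 d1) (derivation0 d2).
have EX : D1 'X = D2 'X by have := Ev m (ltnSn m); rewrite /= eqxx.
rewrite d1.1 d2.1 d1.2 d2.2 IHp EX; congr (_ + _); apply: E => //= i lt_im.
by have := Ev i (ltnW lt_im); rewrite /= ltn_eqF.
Qed.

Lemma derivation_deriv (A : comNzRingType) : derivation id (@deriv A).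
Proof. by split=> p q /=; rewrite ?derivD // derivM addrC. Qed.

Lemma derivation_map (A : comNzRingType) (D : A -> A) :
  derivation id D -> derivation id (map_poly D).
Proof.
move=> dD; have D0 := derivation0 dD.
split=> p q; apply/polyP => i; rewrite ?coefD !coef_map_id0 ?coefD ?dD.1 //.
rewrite !coefM (derivation_sum _ _ _ dD) -big_split; apply: eq_bigr => j _ /=.
by rewrite dD.2 !coef_map_id0.
Qed.

Variable K : comNzRingType.

(** The partial derivative with respect to [mvar K m i]; it is zero when [i >= m], in accordance
    with [mvar]. *)
Fixpoint pd (m i : nat) : mpoly K m -> mpoly K m :=
  match m return mpoly K m -> mpoly K m with
  | 0 => fun=> 0
  | m'.+1 => fun f => if i == m' then deriv (f : {poly mpoly K m'}) else map_poly (pd (m := m') i) f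
  end.

Lemma derivation_pd m i : derivation id (@pd m i).
Proof.
elim: m => [|m IHm] /=; first by split=> a b; rewrite ?mulr0 ?mul0r addr0.
by case: eqP => _; [apply: derivation_deriv | apply: derivation_map].
Qed.

Lemma pd_polyC m i c : (i < m)%N -> @pd m.+1 i c%:P = (@pd m i c)%:P.
Proof.
move=> lt_im /=; rewrite ltn_eqF //; apply/polyP => j.
by rewrite coef_map_id0 ?(derivation0 (derivation_pd m i)) // !coefC; case: eqP => _ //;
  rewrite (derivation0 (derivation_pd m i)).
Qed.

Lemma pd_const m i c : @pd m i (mconst m c) = 0.
Proof.
elim: m => //= m IHm; case: eqP => _; first by rewrite derivC.
apply/polyP => j; rewrite coef_map_id0 ?(derivation0 (derivation_pd m i)) // coefC coef0.
by case: eqP => _ //; rewrite (derivation0 (derivation_pd m i)).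
Qed.

Lemma pd_var m i j : (j < m)%N -> @pd m i (mvar K m j) = (i == j)%:R.
Proof.
elim: m => //= m IHm; have D0 := derivation0 (derivation_pd m i).
rewrite ltnS leq_eqVlt; case: (j =P m) => [-> _|_ /= lt_jm].
  case: eqP => _; first by rewrite derivX.
  apply/polyP => l; rewrite coef_map_id0 // coefX coef0; case: eqP => _ //.
  have := pd_const m i 1; rewrite rmorph1 => ->; by [].
case: eqP => [->|_].
  by rewrite derivC gtn_eqF.
apply/polyP => l; rewrite coef_map_id0 // coefC -polyC_natr coefC; case: eqP => _ //.
exact: IHm.
Qed.

Lemma pd_last m (f : {poly mpoly K m}) : @pd m.+1 m f = f^`().
Proof. by rewrite /= eqxx. Qed.

Arguments pd m i f : simpl never.

(** The commutator of two derivations is a derivation, and this one kills constants and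
    variables. *)
Lemma pdC m i j f : @pd m i (pd j f) = pd j (pd i f).
Proof.
pose D f := @pd m i (pd j f) - pd j (pd i f).
suff: D f = 0 by move/eqP; rewrite subr_eq0 => /eqP.
have [di dj] := (derivation_pd m i, derivation_pd m j).
have dD : derivation idfun D.
  split=> a b; rewrite /D; first by rewrite !(di.1, dj.1); ring.
  rewrite dj.2 di.2 !di.1 !dj.1 !dj.2 !di.2 /=; ring.
apply: (derivation_mpoly_ext (phi := idfun) (D2 := fun=> 0) dD) => [|c|l lt_l].
- by split=> a b; rewrite ?mulr0 ?mul0r addr0.
- by rewrite /D !pd_const (derivation0 di) (derivation0 dj) subr0.
- by rewrite /D !pd_var // -[_%:R](rmorph_nat (@mconst K m)) -[(i == l)%:R](rmorph_nat (@mconst K m)) !pd_const subr0.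
Qed.

(** The chain rule: both sides are derivations along [phi] that agree on constants and variables. *)
Lemma derivation_mpolyE (B : comNzRingType) m (phi : {rmorphism mpoly K m -> B}) D f :
  derivation phi D -> (forall c, D (mconst m c) = 0) ->
  D f = \sum_(i < m) D (mvar K m i) * phi (pd i f).
Proof.
move=> dD Dc; apply: (derivation_mpoly_ext dD
  (D2 := fun f => \sum_(i < m) D (mvar K m i) * phi (pd i f))) => [|c|i lti].
- by apply: derivation_comb => i; apply: (derivation_rmorph phi (derivation_pd m i)).
- by rewrite Dc big1 // => i _; rewrite pd_const rmorph0 mulr0.
rewrite (bigD1 (Ordinal lti)) //= pd_var // eqxx rmorph1 mulr1 big1 ?addr0 // => j.
by rewrite -val_eqE /= => /negPf ji; rewrite pd_var // ji rmorph0 mulr0.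
Qed.

End Derivations.
Arguments pd {K m} i f : simpl never.

(** Since [mpoly K n] is declared only as a commutative ring, the field is built recursively, as the
    rational functions in one variable over the previous field. *)
Lemma mpoly_embedding (K : fieldType) n :
  exists (L : fieldType) (iota : {rmorphism mpoly K n -> L}), injective iota.
Proof.
elim: n => [|n [L [iota inj_iota]]]; first by exists K, idfun.
exists {fraction {poly L}}, (@tofrac {poly L} \o map_poly iota) => f g /= /eqP.
by rewrite tofrac_eq => /eqP; apply: map_inj_poly; rewrite ?rmorph0.
Qed.

(** * Tangent vectors and Jacobians *)

Section Tangent.
Variables (K : fieldType) (n : nat) (L : fieldType).
Variable iota : {rmorphism mpoly K n -> L}.
Hypothesis iota_inj : injective iota.
Hypothesis K0 : [pchar K] =i pred0.

Notation msub m G := (mev (@mconst K n) m G).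

Lemma iota_eq0 a : (iota a == 0) = (a == 0).
Proof. by rewrite -(inj_eq iota_inj) rmorph0. Qed.

Lemma natrL_neq0 r : r.+1%:R != 0 :> L.
Proof.
have -> : r.+1%:R = (iota \o mconst n) r.+1%:R by rewrite rmorph_nat.
by rewrite fmorph_eq0 (pcharf0P _).1.
Qed.

Definition grad (g : mpoly K n) : 'rV[L]_n := \row_j iota (pd j g).

Lemma grad_msubst m (f : mpoly K m) G :
  grad (msubst f G) = \sum_(i < m) iota (msubst (pd i f) G) *: grad (G i).
Proof.
apply/rowP => j; rewrite mxE summxE.
rewrite -[pd j _]/((pd j \o msub m G) f).
rewrite (derivation_mpolyE f (derivation_comp (msub m G) (derivation_pd K n j))) => [|c] /=.
  by rewrite rmorph_sum; apply: eq_bigr => i _ /=; rewrite !mxE mev_var // rmorphM mulrC.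
by rewrite mev_const pd_const.
Qed.

(** The Zariski tangent space, at the generic point [G], of the variety defined by the relations of
    [G]. *)
Definition tangent m (G : nat -> mpoly K n) (v : nat -> L) : Prop :=
  forall f : mpoly K m, msubst f G = 0 -> \sum_(i < m) v i * iota (msubst (pd i f) G) = 0.

(** Pseudo-division inside the kernel of [phi]: each [f] is reduced by some [P] of no larger degree
    with [D P = 0], and the multiplier of [f] survives under [phi], so [D f = 0] follows from the
    case of lower degree. *)
Lemma derivation_eq0_on_kernel (A : comNzRingType) (phi : {rmorphism {poly A} -> L})
    (D : {poly A} -> L) :
  derivation phi D -> (forall c : A, phi c%:P = 0 -> D c%:P = 0) ->
  (forall s f, phi f = 0 -> (size f <= s.+1)%N -> phi (f`_s)%:P <> 0 ->
     exists r P, [/\ phi P = 0, (size P <= r.+1)%N,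
       phi (P`_r)%:P <> 0, (r <= s)%N & D P = 0]) ->
  forall f, phi f = 0 -> D f = 0.
Proof.
move=> dD Dc HP f; have [N leN] := ubnP (size f).
elim: N f leN => // N IHN f; rewrite ltnS => szf Gf.
case: N IHN szf => [_|N IHN szf].
  by rewrite leqn0 size_poly_eq0 => /eqP ->; rewrite (derivation0 dD).
have [c0|c0] := classic (phi (f`_N)%:P = 0).
  pose f1 := f - (f`_N)%:P * 'X^N.
  have Df : D f = D f1.
    by rewrite (derivationB _ _ dD) dD.2 (Dc _ c0) /= c0 !mul0r addr0 subr0.
  rewrite Df; apply: IHN; last by rewrite rmorphB rmorphM c0 mul0r subr0.
  rewrite ltnS; apply/leq_sizeP => j; rewrite leq_eqVlt /f1 coefB coefCM coefXn.
  case/predU1P => [<-|ltj]; first by rewrite eqxx mulr1 subrr.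
  by rewrite gtn_eqF // mulr0 subr0 nth_default // (leq_trans szf).
have [r [P [GP szP Pr le_rN DP]]] := HP N f Gf szf c0.
pose f1 := (P`_r)%:P * f - (f`_N)%:P * 'X^(N - r) * P.
have: D f1 = 0.
  apply: IHN; last by rewrite rmorphB !rmorphM Gf GP !mulr0 subr0.
  rewrite ltnS; apply/leq_sizeP => j; rewrite leq_eqVlt /f1 coefB -mulrA !coefCM coefXnM => lej.
  have geNr : (N - r <= j)%N by lia.
  rewrite ltnNge geNr /=.
  case/predU1P: lej => [<-|ltj]; first by rewrite subKn // mulrC subrr.
  have fj : f`_j = 0 by rewrite nth_default // (leq_trans szf).
  have Pj : P`_(j - (N - r)) = 0 by rewrite nth_default // (leq_trans szP) //; lia.
  by rewrite fj Pj !mulr0 subr0.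
rewrite (derivationB _ _ dD) !dD.2 GP Gf DP !mulr0 !addr0 subr0.
by move/eqP; rewrite mulf_eq0 => /orP[/eqP //|/eqP].
Qed.

(** The new coordinate [w] only has to satisfy one equation, given by a relation [P] of least degree
    in the last variable; pseudo-division by [P] handles the other relations. *)
Lemma tangent_extend m (G : nat -> mpoly K n) v : tangent m G v ->
  exists w, tangent m.+1 G (fun i => if i == m then w else v i).
Proof.
move=> Tv.
pose D w (f : mpoly K m.+1) :=
  \sum_(i < m.+1) (if i == m :> nat then w else v i) * iota (msubst (pd i f) G).
have dD w : derivation (iota \o msub m.+1 G) (D w).
  by apply: derivation_comb => i; apply: (derivation_rmorph (iota \o msub m.+1 G) (derivation_pd _ _ i)).
have DE w f : D w f = D 0 f + w * iota (msubst (@pd K m.+1 m f) G).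
  rewrite /D !big_ord_recr /= eqxx mul0r addr0; congr (_ + _).
  by apply: eq_bigr => i _; rewrite ltn_eqF.
have msubC (c : mpoly K m) : msub m.+1 G (c%:P : {poly mpoly K m}) = msubst c G.
  by rewrite mev_polyE map_polyC hornerC.
have DC w (c : mpoly K m) : msubst c G = 0 -> D w (c%:P : {poly mpoly K m}) = 0.
  move=> Gc; rewrite DE /D big_ord_recr /= eqxx mul0r addr0 pd_last derivC [msubst 0 _](rmorph0 (msub m.+1 G)) rmorph0 mulr0 addr0.
  rewrite -[RHS](Tv _ Gc); apply: eq_bigr => i _; rewrite ltn_eqF //.
  by rewrite pd_polyC // -[in RHS]msubC.
pose phi0 : {rmorphism mpoly K m.+1 -> L} := iota \o msub m.+1 G.
pose phi : {rmorphism {poly mpoly K m} -> L} := phi0.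
have K2 f : phi f = 0 -> msub m.+1 G f = 0 by move/eqP; rewrite iota_eq0 => /eqP.
have K1 (c : mpoly K m) : phi c%:P <> 0 -> msubst c G <> 0.
  by move=> + c0; rewrite /= msubC c0 rmorph0.
have K3 (c : mpoly K m) : msubst c G <> 0 -> phi c%:P <> 0.
  by move=> + /K2; rewrite msubC.
have DK w (c : mpoly K m) : phi c%:P = 0 -> D w (c%:P : {poly mpoly K m}) = 0.
  by move/K2; rewrite msubC; apply: DC.
have key w := @derivation_eq0_on_kernel _ phi (D w) (dD w) (DK w).
pose good s (P : {poly mpoly K m}) :=
  [/\ msub m.+1 G P = 0, (size P <= s.+1)%N & msubst P`_s G <> 0].
have [[s Ps]|nogood] := classic (exists s P, good s P); last first.
  (* Here every relation has only coefficients that are themselves relations, so any [w] would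
     do. *)
  exists 0 => f Gf; apply: (key 0) => [s g /K2 Gg sg cg|].
    by case: nogood; exists s, g; split=> //; apply: K1.
  by rewrite /= [mev _ _ _ _]Gf rmorph0.
have {s Ps} [r [P [[GP szP Pr] minP]]] :
    exists r P, good r P /\ forall s Q, good s Q -> (r <= s)%N.
  elim/ltn_ind: s Ps => s IHs [P gP].
  have [[s' [Q [gQ lts]]]|min] := classic (exists s' Q, good s' Q /\ (s' < s)%N).
    by apply: (IHs s' lts); exists Q.
  exists s, P; split=> // s' Q gQ; rewrite leqNgt; apply/negP => lts.
  by apply: min; exists s', Q.
(* Separability: in characteristic zero the top coefficient of the derivative is a nonzero multiple
   of that of [P], so its vanishing at [G] would contradict minimality. *)
have P'0 : msub m.+1 G P^`() <> 0.
  move=> GP'; case: r => [|r] in szP Pr minP.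
    by case: Pr; rewrite -msubC -(size1_polyC szP).
  have := minP r P^`(); rewrite ltnn => F; apply: notF; apply: F; split=> //.
    by apply: leq_trans (leq_sub2r 1 szP); rewrite subn1 /= (leq_trans (size_poly _ _)) ?leqnn.
  rewrite coef_deriv -[msubst _ _]/(msub m G _) rmorphMn => /(congr1 iota) /eqP.
  rewrite rmorphMn rmorph0 -mulr_natr mulf_eq0 (negPf (natrL_neq0 r)) orbF iota_eq0 => /eqP.
  exact: Pr.
(* The solution [w] of the linear equation [D w P = 0]. *)
exists (- (D 0 P / iota (msub m.+1 G P^`()))) => f Gf; set w := - _.
have DP : D w P = 0.
  rewrite DE pd_last /w mulNr mulfVK ?subrr // iota_eq0; exact/eqP.
apply: (key w) => [s g /K2 Gg sg cg|]; last by rewrite /= [mev _ _ _ _]Gf rmorph0.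
exists r, P; split=> //; [by rewrite /= GP rmorph0 | exact: K3 |].
by apply: (minP s g); split=> //; apply: K1.
Qed.

(** The converse is the chain rule. For the direct implication, the variables [x] are appended to
    [G] and [v] is extended along them; the new coordinates form [w], and the relation that writes
    [G i] as a polynomial in [x] forces the formula. *)
Lemma tangentP m (G : nat -> mpoly K n) v :
  tangent m G v <-> exists w : 'rV[L]_n, forall i, (i < m)%N -> v i = \sum_j w 0 j * iota (pd j (G i)).
Proof.
split=> [Tv|[w Ew] f Gf]; last first.
  rewrite (eq_bigr (fun i : 'I_m => \sum_j w 0 j * (iota (msubst (pd i f) G) *: grad (G i)) 0 j)).
    rewrite exchange_big big1 // => j _; rewrite -mulr_sumr -summxE -grad_msubst Gf !mxE.
    by rewrite (derivation0 (derivation_pd _ _ _)) rmorph0 mulr0.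
  move=> i _; rewrite Ew // mulr_suml; apply: eq_bigr => j _; rewrite !mxE; ring.
pose G' i := if (i < m)%N then G i else mvar K n (i - m).
have {Tv} Tv : tangent m G' v.
  have E (g : mpoly K m) : msubst g G' = msubst g G.
    apply: (rmorph_mev (phi := idfun) (c := @mconst K n) (c' := @mconst K n)) => // i lti /=.
    by rewrite /G' lti.
  by move=> f; rewrite E => /Tv {2}<-; apply: eq_bigr => i _; rewrite E.
have ext d : exists v', (forall i, (i < m)%N -> v' i = v i) /\ tangent (d + m) G' v'.
  elim: d => [|d [v' [Ev' /tangent_extend[w Tw]]]]; first by exists v.
  exists (fun i => if i == (d + m)%N then w else v' i); split=> // i lti.
  by rewrite ltn_eqF ?Ev' // ltn_addl.
have {ext} [v' [Ev' Tv']] := ext n.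
exists (\row_(j < n) v' (m + j)%N) => i lti; rewrite -Ev' //.
pose psi : {rmorphism mpoly K (n + m) -> mpoly K n} := msub (n + m) G'.
(* A section of [psi]: it writes an element of [K[x]] in the last [n] variables. *)
pose sg : {rmorphism mpoly K n -> mpoly K (n + m)} :=
  mev (@mconst K (n + m)) n (fun l => mvar K (n + m) (m + l)).
pose D (f : mpoly K (n + m)) := \sum_(l < n + m) v' l * iota (psi (pd l f)).
have dD : derivation (iota \o psi) D.
  by apply: derivation_comb => l; apply: (derivation_rmorph (iota \o psi) (derivation_pd _ _ l)).
have Dvar l : (l < n + m)%N -> D (mvar K (n + m) l) = v' l.
  move=> ltl; rewrite /D (bigD1 (Ordinal ltl)) //= pd_var // eqxx /= !rmorph1 mulr1.
  rewrite big1 ?addr0 // => l' nl; rewrite pd_var // (_ : (_ == l) = false) ?rmorph0 ?mulr0 //.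
  exact: negPf nl.
have Dconst c : D (mconst (n + m) c) = 0.
  by rewrite /D big1 // => l _; rewrite pd_const !rmorph0 mulr0.
have psivar l : (l < n + m)%N -> psi (mvar K (n + m) l) = G' l by exact: mev_var.
have psisg g : psi (sg g) = g.
  apply: (rmorphism_mpoly_ext (phi := psi \o sg) (psi := idfun)) => [c|l ltl] /=.
    by rewrite !mev_const.
  by rewrite mev_var // mev_var 1?addnC ?ltn_add2r // /G' ltnNge leq_addl addnK.
have: D (mvar K (n + m) i - sg (G i)) = 0.
  apply: Tv'; rewrite -[msubst _ _]/(psi _) rmorphB psisg psivar ?ltn_addl //.
  by rewrite /G' lti subrr.
rewrite (derivationB _ _ dD) Dvar ?ltn_addl // => /eqP; rewrite subr_eq0 => /eqP ->.
rewrite -[D _]/((D \o sg) (G i)) (derivation_mpolyE _ (derivation_comp sg dD)) => [|c] /=.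
  apply: eq_bigr => l _; rewrite psisg mxE; congr (_ * _).
  by rewrite mev_var // Dvar // addnC ltn_add2r.
by rewrite mev_const Dconst.
Qed.

Definition jac m (G : nat -> mpoly K n) : 'M[L]_(m, n) := \matrix_(i < m) grad (G i).
Arguments jac m G : clear implicits.

Lemma jacE m (G : nat -> mpoly K n) (i : 'I_m) j : jac m G i j = iota (pd j (G i)).
Proof. by rewrite !mxE. Qed.

Lemma tangent_jacP m (G : nat -> mpoly K n) (v : nat -> L) :
  tangent m G v <-> exists w : 'cV[L]_n, \col_(i < m) v i = jac m G *m w.
Proof.
rewrite tangentP; split=> [[w Ew]|[w Ew]].
  exists w^T; apply/colP => i; rewrite !mxE Ew //; apply: eq_bigr => j _.
  by rewrite jacE mxE mulrC.
exists w^T => i lti; have /colP/(_ (Ordinal lti)) := Ew; rewrite !mxE => ->.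
by apply: eq_bigr => j _; rewrite jacE mxE mulrC.
Qed.

(** * Taylor coefficients in [t] and image apices *)

Lemma coef0_msubst m (f : mpoly K m) (U : nat -> {poly mpoly K n}) :
  (msubst (n := n.+1) f U : {poly mpoly K n})`_0 = msubst f (fun i => (U i)`_0).
Proof.
pose c0 : {rmorphism K -> mpoly K n.+1} := @mconst K n.+1.
pose c1 : {rmorphism K -> {poly mpoly K n}} := c0.
by apply: (rmorph_mev (phi := coefp 0) (c := c1)) => // a; rewrite /= coefC.
Qed.

Lemma derivation_coef1 m (U : nat -> {poly mpoly K n}) :
  derivation (msub m (fun i => (U i)`_0))
    (fun f => (mev (@mconst K n.+1) m U f : {poly mpoly K n})`_1).
Proof.
split=> f g; first by rewrite rmorphD coefD.
rewrite rmorphM coefM big_ord_recl big_ord1 /= subnn.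
by rewrite -![_`_0]/((msubst (n := n.+1) _ U)`_0) !coef0_msubst.
Qed.

Lemma coef1_msubst m (f : mpoly K m) (U : nat -> {poly mpoly K n}) :
  (msubst (n := n.+1) f U : {poly mpoly K n})`_1 =
  \sum_(i < m) (U i)`_1 * msubst (pd i f) (fun i => (U i)`_0).
Proof.
apply: etrans (derivation_mpolyE f (derivation_coef1 m U) _) _ => [c|].
  by rewrite mev_const /= coefC.
by apply: eq_bigr => i _; rewrite mev_var.
Qed.

Definition kL : {rmorphism K -> L} := iota \o @mconst K n.

Lemma mconst_eq0 (c : K) : (mconst n c == 0) = (c == 0).
Proof. by rewrite -iota_eq0 -[iota _]/(kL c) fmorph_eq0. Qed.

(** The coefficient of [t] in [f(G + tp)] is the derivative of [f] along [p] at [G], which gives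
    tangency. Conversely, tangency makes that derivative a relation again, so induction on the power
    of [t] kills every coefficient, with division by [r + 1] in characteristic zero. *)
Lemma proj_image_apexP m (G : nat -> mpoly K n) (p : 'cV[K]_m) :
  proj_image_apex G p <-> p != 0 /\ tangent m G (fun i => kL (cvnat p i)).
Proof.
pose U i : {poly mpoly K n} := (G i)%:P + 'X * (mconst n (cvnat p i))%:P.
have U0 i : (U i)`_0 = G i by rewrite coefD coefC coefXM addr0.
have U1 i : (U i)`_1 = mconst n (cvnat p i) by rewrite coefD coefC coefXM coefC add0r.
have F0 (f : mpoly K m) : (msubst (n := n.+1) f U : {poly mpoly K n})`_0 = msubst f G.
  by rewrite coef0_msubst; apply: (rmorph_mev (phi := idfun) (c := @mconst K n)) => // i _; apply: U0.
have F1 (f : mpoly K m) : (msubst (n := n.+1) f U : {poly mpoly K n})`_1 =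
    \sum_(i < m) mconst n (cvnat p i) * msubst (pd i f) G.
  by rewrite coef1_msubst; apply: eq_bigr => i _; rewrite U1 -F0 coef0_msubst.
split=> -[p0 Hp]; split=> // f Gf.
  have := Hp f Gf; rewrite -/U => /(congr1 (fun P : {poly mpoly K n} => iota P`_1)).
  rewrite F1 coef0 rmorph0 rmorph_sum => E; rewrite -[RHS]E; apply: eq_bigr => i _.
  exact/esym/rmorphM.
suff H r : forall f : mpoly K m, msubst f G = 0 ->
    (msubst (n := n.+1) f U : {poly mpoly K n})`_r = 0.
  by apply/polyP => r; rewrite -/U H ?coef0.
elim: r => [|r IHr] {Gf} {}f Gf; first by rewrite F0.
pose Dp := \sum_(i < m) mconst m (cvnat p i) * pd i f.
have GDp : msubst Dp G = 0.
  apply: iota_inj; rewrite rmorph0 -(Hp f Gf) -[msubst _ _]/(msub m G _) !rmorph_sum.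
  by apply: eq_bigr => i _; rewrite !rmorphM /= mev_const.
have : (msubst (n := n.+1) f U : {poly mpoly K n})^`() = msubst (n := n.+1) Dp U.
  rewrite -[LHS]/((@deriv _ \o mev (@mconst K n.+1) m U) f).
  have dd := derivation_comp (mev (@mconst K n.+1) m U) (derivation_deriv (mpoly K n)).
  rewrite (derivation_mpolyE f dd) => [|c] /=; last by rewrite mev_const derivC.
  rewrite -[RHS]/(mev (@mconst K n.+1) m U _) rmorph_sum; apply: eq_bigr => i _.
  rewrite rmorphM /= mev_const mev_var // /U derivD derivC add0r derivM derivX derivC.
  by rewrite mulr0 addr0 mul1r.
move=> /(congr1 (fun P : {poly mpoly K n} => P`_r)); rewrite coef_deriv IHr //.
move=> /(congr1 iota) /eqP; rewrite rmorphMn rmorph0 -mulr_natr mulf_eq0.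
by rewrite (negPf (natrL_neq0 r)) orbF iota_eq0 => /eqP.
Qed.

Lemma cvnatE (F : comNzRingType) m (p : 'cV[F]_m) (i : 'I_m) : cvnat p i = p i 0.
Proof. by rewrite /cvnat valK. Qed.

Lemma proj_apex_jacP m (G : nat -> mpoly K n) (p : 'cV[K]_m) :
  proj_image_apex G p <-> p != 0 /\ exists w : 'cV[L]_n, map_mx kL p = jac m G *m w.
Proof.
rewrite proj_image_apexP tangent_jacP; suff -> : \col_(i < m) kL (cvnat p i) = map_mx kL p by [].
by apply/colP => i; rewrite !mxE cvnatE.
Qed.

(** Otherwise the basis vector of index [l] would be tangent, hence a projective image apex. *)
Lemma noapex_relation m (G : nat -> mpoly K n) (l : 'I_m) :
  (forall p : 'cV[K]_m, ~ proj_image_apex G p) ->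
  exists f : mpoly K m, msubst f G = 0 /\ msubst (pd l f) G <> 0.
Proof.
move=> noG; have [//|nof] := classic (exists f : mpoly K m, msubst f G = 0 /\ msubst (pd l f) G <> 0).
case: (noG (delta_mx l 0)); apply/proj_image_apexP; split.
  by apply/eqP => /matrixP/(_ l 0); rewrite !mxE !eqxx => /eqP; rewrite oner_eq0.
move=> f Gf; rewrite big1 // => i _; rewrite cvnatE !mxE eqxx andbT.
case: eqP => [->|_]; last by rewrite rmorph0 mul0r.
have [->|nf] := classic (msubst (pd l f) G = 0); first by rewrite rmorph0 mulr0.
by case: nof; exists f.
Qed.

(** With independent gradients every vector would be tangent, in particular the first basis
    vector. *)
Lemma noapex_rank m (G : nat -> mpoly K n) : (0 < m)%N ->
  (forall p : 'cV[K]_m, ~ proj_image_apex G p) -> (\rank (jac m G) < m)%N.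
Proof.
move=> m0 noG; rewrite ltn_neqAle rank_leq_row andbT; apply/negP => rk.
have full : row_full (jac m G)^T by rewrite /row_full mxrank_tr.
case: (noG (delta_mx (Ordinal m0) 0)); apply/proj_apex_jacP; split.
  by apply/eqP => /matrixP/(_ (Ordinal m0) 0); rewrite !mxE !eqxx => /eqP; rewrite oner_eq0.
have /submxP[w Ew] : ((map_mx kL (delta_mx (Ordinal m0) 0 : 'cV[K]_m))^T <= (jac m G)^T)%MS by apply: submx_full.
by exists w^T; apply: trmx_inj; rewrite Ew trmx_mul trmxK.
Qed.

(** Up to sign, this is the coefficient of [t] in [f((1-t)G + ta)]. The tangent vector [G - a] is
    the value of the Euler field centred at [a]. *)
Lemma image_apex_tangent m (G : nat -> mpoly K n) (a : 'cV[K]_m) :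
  image_apex G a -> tangent m G (fun i => iota (G i - mconst n (cvnat a i))).
Proof.
move=> Ga f Gf; pose U i : {poly mpoly K n} := (1 - 'X) * (G i)%:P + 'X * (mconst n (cvnat a i))%:P.
have U0 i : (U i)`_0 = G i.
  by rewrite coefD coefXM addr0 mulrBl mul1r coefB coefXM subr0 coefC.
have U1 i : (U i)`_1 = mconst n (cvnat a i) - G i.
  by rewrite coefD coefXM mulrBl mul1r coefB coefXM !coefC /= sub0r addrC.
have F0 (g : mpoly K m) : (msubst (n := n.+1) g U : {poly mpoly K n})`_0 = msubst g G.
  by rewrite coef0_msubst; apply: (rmorph_mev (phi := idfun) (c := @mconst K n)) => // i _; apply: U0.
have := Ga f Gf; rewrite -/U => /(congr1 (fun P : {poly mpoly K n} => - iota P`_1)).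
rewrite coef1_msubst coef0 rmorph0 oppr0 rmorph_sum -sumrN => E; rewrite -[RHS]E.
apply: eq_bigr => i _.
by rewrite U1 -F0 coef0_msubst -[RHS]rmorphN -mulNr opprB rmorphM.
Qed.

(** * Algebraic independence and transcendence degree as Jacobian ranks *)

Lemma mpoly_mulrSn_eq0 m (a : mpoly K m) r : a *+ r.+1 = 0 -> a = 0.
Proof.
elim: m a => [|m IHm] a /=.
  by move/eqP; rewrite -mulr_natr mulf_eq0 (pcharf0P _).1 // orbF => /eqP.
move=> /polyP a0; apply/polyP => i; rewrite coef0; apply: IHm.
by have := a0 i; rewrite coefMn coef0.
Qed.

(** Differentiating in the last variable down to degree zero leaves a factorial times the leading
    coefficient, to which the induction on the number of variables applies. *)
Lemma pd_closed_eq0 m (S : mpoly K m -> Prop) :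
  (forall i f, (i < m)%N -> S f -> S (pd i f)) ->
  (forall c, S (mconst m c) -> c = 0) -> forall f, S f -> f = 0.
Proof.
elim: m S => [|m IHm] S Spd Sc f Sf; first exact: Sc.
pose S' (g : mpoly K m) := S (g%:P : {poly mpoly K m}).
have S'0 g : S' g -> g = 0.
  apply: (IHm S') => [i h lti Sh|c]; last exact: Sc.
  by rewrite /S' -pd_polyC //; apply: Spd => //; apply: ltnW.
have claim r : forall f : {poly mpoly K m}, S f -> (size f <= r.+1)%N -> S' (f`_r *+ r`!).
  elim: r => [|r IHr] g Sg szg; first by rewrite /S' mulr1n -size1_polyC.
  have := IHr g^`(); rewrite coef_deriv -mulrnA -factS; apply.
    by have := Spd m g (ltnSn m) Sg; rewrite pd_last.
  by rewrite (leq_trans (size_poly _ _)) // -ltnS; case: (size g) szg.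
have [//|nzf] := eqVneq (f : {poly mpoly K m}) 0.
have := claim (size (f : {poly mpoly K m})).-1 f Sf; rewrite prednK ?size_poly_gt0 // => /(_ (leqnn _)) /S'0.
rewrite -[_`!]prednK ?fact_gt0 // => /mpoly_mulrSn_eq0 /eqP.
by rewrite [_ == 0]lead_coef_eq0 (negPf nzf).
Qed.

(** Without relations every vector is tangent, so the rank is full. With full rank every basis
    vector is tangent, so the relations are stable under partial derivatives and contain no nonzero
    constant. *)
Lemma alg_indepP d (G : nat -> mpoly K n) : alg_indep d G <-> \rank (jac d G) = d.
Proof.
rewrite -mxrank_tr; split=> [Gi|rk].
  apply/eqP; rewrite -[_ == d]/(row_full _) -sub1mx; apply/row_subP => i.
  have : tangent d G (fun i' => (i == i' :> nat)%:R).
    move=> f /Gi ->; rewrite big1 // => l _.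
    by rewrite (derivation0 (derivation_pd _ _ _)) [msubst 0 _](rmorph0 (msub d G)) rmorph0 mulr0.
  move/tangent_jacP => [w Ew]; suff -> : row i 1%:M = w^T *m (jac d G)^T by apply: submxMl.
  by rewrite -trmx_mul -Ew; apply/rowP => j; rewrite !mxE.
have full : row_full (jac d G)^T by rewrite /row_full rk.
apply: (pd_closed_eq0 (S := fun f => msubst f G = 0)) => [i f lti Gf|c]; last first.
  by rewrite [msubst _ _]mev_const => /eqP; rewrite mconst_eq0 => /eqP.
have : tangent d G (fun i' => (i == i' :> nat)%:R).
  apply/tangent_jacP; have /submxP[w Ew] : ((\col_(j < d) (i == j :> nat)%:R : 'cV[L]_d)^T <= (jac d G)^T)%MS by apply: submx_full.
  by exists w^T; apply: trmx_inj; rewrite Ew trmx_mul trmxK.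
move=> /(_ f Gf); rewrite (bigD1 (Ordinal lti)) //= eqxx mul1r big1 => [|j].
  by rewrite addr0 => /eqP; rewrite iota_eq0 => /eqP.
by rewrite -val_eqE eq_sym /= => /negPf ->; rewrite mul0r.
Qed.

Lemma jac_subfam m (G : nat -> mpoly K n) (S : {set 'I_m}) :
  jac #|S| (subfam G S) = rowsub (fun i : 'I_#|S| => enum_val i) (jac m G).
Proof.
apply/matrixP => i j; rewrite !mxE /subfam.
by rewrite (nth_map (enum_default i)) // -cardE.
Qed.

Lemma is_trdegP m (G : nat -> mpoly K n) d : is_trdeg m G d <-> \rank (jac m G) = d.
Proof.
have le (S : {set 'I_m}) : alg_indep #|S| (subfam G S) -> (#|S| <= \rank (jac m G))%N.
  by rewrite alg_indepP jac_subfam => {1}<-; apply/mxrankS/rowsub_sub.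
have [S [cS iS]] : exists S : {set 'I_m}, #|S| = \rank (jac m G) /\ alg_indep #|S| (subfam G S).
  (* The rows of the Jacobian indexed by [S] form a basis of its row space. *)
  pose g := maxrankfun (jac m G); pose S := [set g i | i in 'I_(\rank (jac m G))].
  have cS : #|S| = \rank (jac m G) by rewrite card_imset ?card_ord //; apply: maxrankfun_inj.
  exists S; split=> //; apply/alg_indepP/eqP; rewrite eqn_leq rank_leq_row jac_subfam {1}cS.
  rewrite -{1}(eqP (maxrowsub_free (jac m G))); apply/mxrankS/row_subP => i.
  have gS : g i \in S by apply: imset_f.
  rewrite row_rowsub -[maxrankfun _ i](enum_rankK_in gS gS).
  by rewrite -(row_rowsub (fun i : 'I_#|S| => enum_val i)) row_sub.
split=> [[[S' [cS' iS']] max]|rk].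
  by apply/eqP; rewrite eqn_leq -{1}cS max // -cS' le.
by rewrite -rk; split; [exists S | exact: le].
Qed.

(** * Proportionality from vanishing Wronskians *)

Lemma mpoly_mulf_eq0 m (a b : mpoly K m) : a * b = 0 -> a = 0 \/ b = 0.
Proof.
have [L' [j inj_j]] := mpoly_embedding K m.
move=> /(congr1 j) /eqP; rewrite rmorphM rmorph0 mulf_eq0 -!(rmorph0 j) !(inj_eq inj_j).
by case/orP=> /eqP; [left | right].
Qed.

Lemma mpoly_mulrn_inj m (a : mpoly K m) d e : a <> 0 -> a *+ d = a *+ e -> d = e.
Proof.
move=> a0; wlog le_de : d e / (d <= e)%N => [W|].
  by case: (leqP d e) => [/W//|/ltnW/W {}W /esym/W].
move=> /eqP; rewrite eq_sym -subr_eq0 -mulrnBr // => /eqP.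
have := subnKC le_de; case: (e - d)%N => [|r] E; first by rewrite -E addn0.
by move/mpoly_mulrSn_eq0.
Qed.

Lemma coef_mul_top (A : comNzRingType) (p q : {poly A}) d e :
  (size p <= d.+1)%N -> (size q <= e.+1)%N -> (p * q)`_(d + e) = p`_d * q`_e.
Proof.
move=> szp szq; have ltd : (d < (d + e).+1)%N by rewrite ltnS leq_addr.
rewrite coefM (bigD1 (Ordinal ltd)) //= addKn big1 ?addr0 // => i; rewrite -val_eqE /= => neq.
have [lti|lti] := ltnP i d; last first.
  have pi : p`_i = 0 by rewrite nth_default //; apply: leq_trans szp _; lia.
  by rewrite pi mul0r.
have qi : q`_(d + e - i) = 0 by rewrite nth_default //; apply: leq_trans szq _; lia.
by rewrite qi mulr0.
Qed.

(** After multiplication by ['X], the top coefficients of the two sides are the degrees of [a] and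
    of [b] times the same nonzero product of leading coefficients. *)
Lemma logder_eq_size m (a b : {poly mpoly K m}) :
  a != 0 -> b != 0 -> b * a^`() = a * b^`() -> size a = size b.
Proof.
move=> a0 b0 E.
have coefXd (p : {poly mpoly K m}) i : ('X * p^`())`_i = p`_i *+ i.
  by rewrite coefXM coef_deriv; case: i.
have szXd (p : {poly mpoly K m}) : p != 0 -> (size ('X * p^`())%R <= (size p).-1.+1)%N.
  move=> p0; apply/leq_sizeP => j; rewrite prednK ?size_poly_gt0 // => lej.
  by rewrite coefXd nth_default ?mul0rn.
have : ('X * (b * a^`()))`_((size b).-1 + (size a).-1) = ('X * (a * b^`()))`_((size b).-1 + (size a).-1).
  by rewrite E.
rewrite (mulrCA _ b) (mulrCA _ a) coef_mul_top ?szXd ?prednK ?size_poly_gt0 // coefXd.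
rewrite addnC coef_mul_top ?szXd ?prednK ?size_poly_gt0 // coefXd.
rewrite !mulrnAr [b`__ * _]mulrC => /mpoly_mulrn_inj H.
suff: ((size a).-1 = (size b).-1)%N.
  rewrite -(size_poly_gt0 a) -(size_poly_gt0 b) in a0 b0; lia.
apply: H => /mpoly_mulf_eq0[] /eqP; rewrite [_ == 0]lead_coef_eq0; exact/negP.
Qed.

(** The leading coefficients satisfy the same equations in fewer variables, which gives [c]. Then
    [a - c b] still has the logarithmic derivative of [b] in the last variable but a smaller degree,
    so it is zero. *)
Lemma wronskian_proportional m (a b : mpoly K m) : b <> 0 ->
  (forall i, (i < m)%N -> b * pd i a = a * pd i b) -> exists c, a = mconst m c * b.
Proof.
elim: m a b => [|m IHm] a b b0 Hab.
  by exists (a / b : K); rewrite /= divfK //; apply/eqP.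
have [a0|a0] := eqVneq (a : {poly mpoly K m}) 0.
  by exists 0; rewrite rmorph0 mul0r.
have {}b0 : (b : {poly mpoly K m}) != 0 by apply/eqP.
have Dab : (b : {poly mpoly K m}) * (a : {poly mpoly K m})^`() = a * b^`().
  by rewrite -!pd_last; apply: Hab.
have sab := logder_eq_size a0 b0 Dab.
have [c Ec] : exists c, lead_coef (a : {poly mpoly K m}) = mconst m c * lead_coef (b : {poly mpoly K m}).
  apply: IHm => [|i lti]; first by apply/eqP; rewrite lead_coef_eq0.
  have := Hab i (ltnW lti); rewrite /pd ltn_eqF // -/pd.
  move/(congr1 (fun p : {poly mpoly K m} => p`_((size (b : {poly mpoly K m})).-1 + (size (a : {poly mpoly K m})).-1))).
  have D0 := derivation0 (derivation_pd K m i).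
  have szm (p : {poly mpoly K m}) : p != 0 -> (size (map_poly (@pd K m i) p) <= (size p).-1.+1)%N.
    by move=> p0; rewrite prednK ?size_poly_gt0 // size_poly.
  rewrite coef_mul_top ?szm ?prednK ?size_poly_gt0 // coef_map_id0 //.
  by rewrite addnC coef_mul_top ?szm ?prednK ?size_poly_gt0 // coef_map_id0.
exists c; apply/eqP; rewrite -subr_eq0; apply/eqP/eqP; set d := a - _.
have [//|d0] := eqVneq (d : {poly mpoly K m}) 0.
have mcE : mconst m.+1 c = (mconst m c)%:P :> {poly mpoly K m} by [].
have: size (d : {poly mpoly K m}) = size (b : {poly mpoly K m}).
  apply: logder_eq_size => //; rewrite /d mcE derivB derivM derivC mul0r add0r mulrBr Dab; ring.
have: (size (d : {poly mpoly K m}) < size (b : {poly mpoly K m}))%N.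
  rewrite -(prednK (n := size (b : {poly mpoly K m}))) ?size_poly_gt0 // ltnS.
  apply/leq_sizeP => j; rewrite leq_eqVlt /d coefB mcE coefCM.
  case/predU1P => [<-|ltj]; first by rewrite -[b`__]/(lead_coef _) -Ec -sab subrr.
  have lej : (size (b : {poly mpoly K m}) <= j)%N.
    by rewrite -(prednK (n := size (b : {poly mpoly K m}))) ?size_poly_gt0.
  have bj : (b : {poly mpoly K m})`_j = 0 by rewrite nth_default.
  have aj : (a : {poly mpoly K m})`_j = 0 by rewrite nth_default // sab.
  by rewrite aj bj mulr0 subr0.
by move=> + E; rewrite E ltnn.
Qed.

(** * Directional derivatives and Wronskians *)

Definition dird (w : 'cV[L]_n) (g : mpoly K n) : L := (grad g *m w) 0 0.

Lemma dirdE w g : dird w g = \sum_j w j 0 * iota (pd j g).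
Proof. by rewrite /dird mxE; apply: eq_bigr => j _; rewrite mxE mulrC. Qed.

Lemma derivation_dird w : derivation iota (dird w).
Proof.
have dD : derivation iota (fun g => \sum_j w j 0 * iota (pd j g)).
  by apply: derivation_comb => j; apply: (derivation_rmorph iota (derivation_pd _ _ j)).
by split=> a b; rewrite !dirdE; [apply: dD.1 | apply: dD.2].
Qed.

Lemma dird_const w c : dird w (mconst n c) = 0.
Proof. by rewrite dirdE big1 // => j _; rewrite pd_const rmorph0 mulr0. Qed.

Lemma tangent_dird m (G : nat -> mpoly K n) v :
  tangent m G v <-> exists w, forall i, (i < m)%N -> v i = dird w (G i).
Proof.
rewrite tangentP; split=> -[w Ew].
  by exists w^T => i /Ew ->; rewrite dirdE; apply: eq_bigr => j _; rewrite mxE.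
by exists w^T => i /Ew ->; rewrite dirdE; apply: eq_bigr => j _; rewrite mxE.
Qed.

Lemma dird_msubst w m (f : mpoly K m) G :
  dird w (msubst f G) = \sum_(i < m) iota (msubst (pd i f) G) * dird w (G i).
Proof.
rewrite /dird grad_msubst mulmx_suml summxE; apply: eq_bigr => i _.
by rewrite -scalemxAl mxE.
Qed.

Lemma jac_mulE m (G : nat -> mpoly K n) (w : 'cV[L]_n) (i : 'I_m) :
  (jac m G *m w) i 0 = dird w (G i).
Proof. by rewrite dirdE mxE; apply: eq_bigr => j _; rewrite jacE mulrC. Qed.

Lemma grad_sub_jac m (G : nat -> mpoly K n) i : (i < m)%N -> (grad (G i) <= jac m G)%MS.
Proof. by move=> lti; have := row_sub (Ordinal lti) (jac m G); rewrite rowK. Qed.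

Lemma jac_subP m (G : nat -> mpoly K n) m' (X : 'M_(m', n)) :
  (forall i, (i < m)%N -> (grad (G i) <= X)%MS) -> (jac m G <= X)%MS.
Proof. by move=> GX; apply/row_subP => i; rewrite rowK; apply: GX. Qed.

Lemma grad_msubst_sub m (f : mpoly K m) G : (grad (msubst f G) <= jac m G)%MS.
Proof.
by rewrite grad_msubst; apply: summx_sub => i _; apply/scalemx_sub/grad_sub_jac.
Qed.

(** This is [b ^ 2] times the differential of [a / b], without the division. *)
Definition wronskian (a b : mpoly K n) : 'rV[L]_n := iota b *: grad a - iota a *: grad b.

Lemma wronskian_mul a b (w : 'cV[L]_n) :
  (wronskian a b *m w) 0 0 = iota b * dird w a - iota a * dird w b.
Proof.
rewrite /wronskian /dird mulmxBl -!scalemxAl.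
by move: (grad a *m w) (grad b *m w) => x y; rewrite !mxE.
Qed.

(** * The ratio forced by a tangent vector that is constant outside one coordinate *)

Section TangentRatio.
Variables (m : nat) (G : nat -> mpoly K n) (P : nat -> K) (e : nat) (mu : L) (f : mpoly K m).
Hypothesis lt_em : (e < m)%N.
Hypothesis Tv : tangent m G (fun i => kL (P i) + (i == e)%:R * mu).
Hypothesis Gf : msubst f G = 0.

(** The derivative of the relation [f] along the constant part [P], taken at [G]; tangency then
    reads [ratio_num + mu * ratio_den = 0]. *)
Definition ratio_num := msubst (\sum_(i < m) mconst m (P i) * pd i f) G.
Definition ratio_den := msubst (pd e f) G.

(** The map [D] is kept abstract to serve twice: for evaluation at [G], and for evaluation followed
    by [dird w]. *)
Lemma sum_tangent_split (D : mpoly K m -> L) :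
  {morph D : a b / a + b} -> (forall c g, D (mconst m c * g) = kL c * D g) ->
  D (\sum_(i < m) mconst m (P i) * pd i f) + mu * D (pd e f) =
  \sum_(i < m) (kL (P i) + (i == e :> nat)%:R * mu) * D (pd i f).
Proof.
move=> DD Dc; have D0 : D 0 = 0 by apply: (addIr (D 0)); rewrite -DD !add0r.
rewrite (big_morph D DD D0); under [RHS]eq_bigr do rewrite mulrDl.
rewrite big_split; congr (_ + _); first by apply: eq_bigr => i _; rewrite Dc.
rewrite (bigD1 (Ordinal lt_em)) //= eqxx mul1r big1 ?addr0 // => i.
by rewrite -val_eqE /= => /negPf ->; rewrite !mul0r.
Qed.

Lemma ratioE : iota ratio_num + mu * iota ratio_den = 0.
Proof.
rewrite -[RHS](Tv Gf).
apply: (sum_tangent_split (D := iota \o msub m G)) => [a b|c g] /=; rewrite ?rmorphD ?rmorphM //=.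
by rewrite mev_const.
Qed.

Lemma wronskian_ratio_sub : (wronskian ratio_num ratio_den <= jac m G)%MS.
Proof. by rewrite addmx_sub ?eqmx_opp // scalemx_sub ?grad_msubst_sub. Qed.

(* Lie bracket of the Euler field with the field lifting [v], evaluated on the relation [f]. *)
Lemma wronskian_ratio_euler (al : nat -> K) (w : 'cV[L]_n) :
  (forall i, (i < m)%N -> dird w (G i) = iota (G i - mconst n (al i))) ->
  (wronskian ratio_num ratio_den *m w) 0 0 = 0.
Proof.
move=> Ew.
pose E (g : mpoly K m) := \sum_(i < m) pd i g * (mvar K m i - mconst m (al i)).
have dirE g : dird w (msubst g G) = iota (msubst (E g) G).
  rewrite dird_msubst -[msubst (E g) _]/(msub m G _) !rmorph_sum; apply: eq_bigr => i _.
  by rewrite Ew // !rmorphM /= [mev _ _ _ (_ - _)]rmorphB /= mev_const mev_var // mulrC.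
(* The bracket of a partial derivative with the Euler operator [E] is that partial derivative. *)
have pdE l g : (l < m)%N -> pd l (E g) = E (pd l g) + pd l g.
  move=> ltl; have dl := derivation_pd K m l.
  rewrite (derivation_sum _ _ _ dl).
  rewrite (eq_bigr (fun i : 'I_m => pd i (pd l g) * (mvar K m i - mconst m (al i))
      + pd i g * (l == i)%:R)); last first.
    by move=> i _; rewrite dl.2 (derivationB _ _ dl) pd_const subr0 pd_var // pdC addrC.
  rewrite big_split; congr (_ + _).
  rewrite (bigD1 (Ordinal ltl)) //= eqxx mulr1 big1 ?addr0 // => i.
  by rewrite -val_eqE eq_sym /= => /negPf ->; rewrite mulr0.
have GEf : msubst (E f) G = 0.
  by apply: iota_inj; rewrite -dirE Gf rmorph0 (derivation0 (derivation_dird w)).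
(* Tangency to the relation [E f], minus tangency to [f]: the commutation rule turns it into the
   equation of [ratioE] differentiated along [w] with [mu] held fixed. *)
have dAB : dird w ratio_num + mu * dird w ratio_den = 0.
  have dd := derivation_comp (msub m G) (derivation_dird w).
  rewrite (sum_tangent_split (D := dird w \o msub m G) dd.1) => [|c g]; last first.
    by rewrite dd.2 /= mev_const dird_const mul0r addr0.
  have S0 := Tv Gf; have := Tv GEf.
  rewrite (eq_bigr (fun l : 'I_m => (kL (P l) + (l == e :> nat)%:R * mu) * (dird w \o msub m G) (pd l f)
      + (kL (P l) + (l == e :> nat)%:R * mu) * iota (msubst (pd l f) G))).
    by rewrite big_split /= S0 addr0.
  move=> l _ /=; rewrite -[mev _ _ _ _]/(msubst _ _) dirE pdE // -mulrDr; congr (_ * _).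
  by rewrite -[msubst (_ + _) _]/(msub m G _) !rmorphD.
have eA : iota ratio_num = - (mu * iota ratio_den) by apply/eqP; rewrite -addr_eq0 ratioE.
have eD : dird w ratio_num = - (mu * dird w ratio_den) by apply/eqP; rewrite -addr_eq0 dAB.
rewrite wronskian_mul eD eA; ring.
Qed.

End TangentRatio.
Lemma grad_derivation j : derivation iota (fun g => grad g 0 j).
Proof.
have [dD dM] := derivation_rmorph iota (derivation_pd K n j).
by split=> a b; rewrite !mxE; [apply: dD | apply: dM].
Qed.

(* If [a / b = - a' / b'], then [d (a / b) = - d (a' / b')]. *)
Lemma wronskian_opp_ratio (lam : L) a b a' b' :
  iota a = lam * iota b -> iota a' = - (lam * iota b') ->
  iota b' ^+ 2 *: wronskian a b = - (iota b ^+ 2 *: wronskian a' b').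
Proof.
move=> Ea Ea'; apply/rowP => j.
have [dD dM] := grad_derivation j.
have e0 : a * b' + a' * b = 0.
  by apply: iota_inj; rewrite rmorphD !rmorphM Ea Ea' rmorph0; ring.
have wE x y : wronskian x y 0 j = iota y * grad x 0 j - iota x * grad y 0 j.
  by rewrite /wronskian; move: (grad x) (grad y) => X Y; rewrite !mxE.
have -> : (iota b' ^+ 2 *: wronskian a b) 0 j = iota b' ^+ 2 * wronskian a b 0 j by rewrite mxE.
have -> : (- (iota b ^+ 2 *: wronskian a' b')) 0 j = - (iota b ^+ 2 * wronskian a' b' 0 j).
  by rewrite mxE [X in - X]mxE.
rewrite !wE; have := congr1 (fun g => grad g 0 j) e0.
rewrite dD !dM (derivation0 (grad_derivation j)).
move: e0 => /(congr1 iota); rewrite rmorphD !rmorphM rmorph0.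
move: (iota a) (iota b) (iota a') (iota b') (grad a 0 j) (grad b 0 j) (grad a' 0 j) (grad b' 0 j).
move=> A B A' B' dA dB dA' dB' E1 E2.
apply/eqP; rewrite -subr_eq0; apply/eqP.
have -> : B' ^+ 2 * (B * dA - A * dB) - - (B ^+ 2 * (B' * dA' - A' * dB')) =
  B * B' * (A * dB' + dA * B' + (A' * dB + dA' * B))
  - (B * dB' + B' * dB) * (A * B' + A' * B) by ring.
by rewrite E1 E2 !mulr0 subrr.
Qed.

(** The part of a constant tangent vector that lies over a block is tangent to the block, so it
    vanishes when the block has no apex. *)
Lemma restrict_apex m M a (G : nat -> mpoly K n) (p : 'cV[K]_M) (w : 'cV[L]_n) (i : 'I_M) :
  map_mx kL p = jac M G *m w -> (a + m <= M)%N ->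
  (forall p' : 'cV[K]_m, ~ proj_image_apex (fun i => G (a + i)%N) p') ->
  (a <= i < a + m)%N -> p i 0 = 0.
Proof.
move=> Ep le_am noG /andP[le_ai lt_iam].
pose p' := \col_(l < m) cvnat p (a + l).
have [p'0|p'0] := eqVneq p' 0; last first.
  case: (noG p'); apply/proj_apex_jacP; split=> //; exists w; apply/colP => l.
  have ltl : (a + l < M)%N by apply: leq_trans le_am; rewrite ltn_add2l.
  rewrite jac_mulE 2!mxE -[(a + l)%N]/(val (Ordinal ltl)) cvnatE.
  by have /colP/(_ (Ordinal ltl)) := Ep; rewrite jac_mulE mxE.
have lti : (i - a < m)%N by lia.
have /colP/(_ (Ordinal lti)) := p'0; rewrite !mxE /= subnKC //.
by rewrite cvnatE.
Qed.

Lemma grad_sub_range (H : nat -> mpoly K n) a b i : (a <= i < b)%N -> (grad (H i) <= jac (b - a) (fun i => H (a + i)%N))%MS.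
Proof.
case/andP=> le_ai lt_ib; have -> : i = (a + (i - a))%N by rewrite subnKC.
by apply: (grad_sub_jac (fun i => H (a + i)%N)); rewrite ltn_sub2r // (leq_ltn_trans le_ai).
Qed.

Lemma range_subP (H : nat -> mpoly K n) a b m' (X : 'M[L]_(m', n)) :
  (forall i, (a <= i < b)%N -> (grad (H i) <= X)%MS) -> (jac (b - a) (fun i => H (a + i)%N) <= X)%MS.
Proof. by move=> HX; apply: jac_subP => i lti; apply: HX; lia. Qed.

(** * Merging the components s and M - 1 *)

Section Main.
Variables (M s k l : nat) (H : nat -> mpoly K n).
Hypotheses (sl : (s < l)%N) (lk : (l <= k)%N) (kM : (k < M)%N).
Let J := jac M H.
Let V a b := jac (b - a) (fun i => H (a + i)%N).

Hypothesis rkJ : \rank J = (M - 2)%N.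
Hypothesis noG1 : forall p : 'cV[K]_(k - s), ~ proj_image_apex (fun i => H (s + i)%N) p.
Hypothesis noG2 : forall p : 'cV[K]_(M - l), ~ proj_image_apex (fun i => H (l + i)%N) p.
Hypothesis rk_rest : (\rank (V s M) <= M - s - 2)%N.

(** A nonzero entry at [i < s] would put the gradient of [H i] in the span of the others, whose rank
    is at most [(s - 1) + (M - s - 2)], below [M - 2]. *)
Lemma jac_kernel0 (u : 'rV[L]_M) (i : 'I_M) : u *m J = 0 -> (i < s)%N -> u 0 i = 0.
Proof.
move=> uJ lt_is; apply/eqP; apply/negP => /negP u0.
pose X := (V 0 i + (V i.+1 s + V s M))%MS.
have gX j : (j < M)%N -> j != i -> (grad (H j) <= X)%MS.
  move=> ltj ji; have [lti|gei] := ltnP j i.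
    by apply: submx_trans (addsmxSl _ _); apply: grad_sub_range.
  apply: submx_trans (addsmxSr _ _); have [lts|ges] := ltnP j s.
    by apply: submx_trans (addsmxSl _ _); apply: grad_sub_range; rewrite lts ltn_neqAle eq_sym ji gei.
  by apply: submx_trans (addsmxSr _ _); apply: grad_sub_range; rewrite ges.
have JX : (J <= X)%MS.
  apply: jac_subP => j ltj; have [->|] := eqVneq j i; last exact: gX.
  have := mulmx_sum_row u J; rewrite uJ (bigD1 i) //= rowK => /esym/eqP.
  rewrite addrC addr_eq0 => /eqP E.
  have -> : grad (H i) = - (u 0 i)^-1 *: \sum_(j0 < M | j0 != i) u 0 j0 *: row j0 J.
    by rewrite E scalerN scaleNr opprK scalerA mulVf ?scale1r.
  apply: scalemx_sub; apply: summx_sub => j' ji; apply: scalemx_sub.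
  by rewrite rowK gX.
have := mxrankS JX; rewrite rkJ leqNgt; apply/negP/negPn.
have r1 := (mxrank_adds_leqif (V 0 i) (V i.+1 s + V s M)%MS).1.
have r2 := (mxrank_adds_leqif (V i.+1 s) (V s M)).1.
have := rank_leq_row (V 0 i); have := rank_leq_row (V i.+1 s).
rewrite -/X in r1; lia.
Qed.

(** As [l <= k], the two blocks without apex cover all the indices from [s] on. Conversely, by
    [jac_kernel0] the column space of [J] contains every vector supported on the first [s]
    coordinates. *)
Lemma proj_apex_H (p : 'cV[K]_M) :
  proj_image_apex H p <-> (p != 0 /\ forall i : 'I_M, (s <= i)%N -> p i 0 = 0).
Proof.
rewrite proj_apex_jacP; split=> -[p0 Hp]; split=> //.
  case: Hp => w Ew i le_si; have [lti|gei] := ltnP i k.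
    by apply: (restrict_apex Ew _ noG1); rewrite ?subnKC ?le_si //; lia.
  by apply: (restrict_apex Ew _ noG2); rewrite ?subnKC ?(leq_trans lk gei) //=; lia.
suff /submxP[w Ew] : ((map_mx kL p)^T <= J^T)%MS.
  by exists w^T; apply: trmx_inj; rewrite Ew trmx_mul trmxK.
rewrite submxE; apply/eqP/rowP => j; rewrite !mxE big1 // => i _.
rewrite !mxE; have [lti|gei] := ltnP i s; last by rewrite Hp // rmorph0 mul0r.
have := jac_kernel0 (u := (col j (cokermx J^T))^T) _ lti; rewrite !mxE => ->; first by rewrite mulr0.
by apply: trmx_inj; rewrite trmx_mul trmxK trmx0 colE mulmxA mulmx_coker mul0mx.
Qed.

Let h : nat -> mpoly K n := fun i => if i == s then H s + H M.-1 else H i.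

Definition merge_mx : 'M[K]_(M - 1, M) :=
  \matrix_(i, j) ((i == j :> nat)%:R + ((i == s :> nat) && (j == M.-1 :> nat))%:R).

Lemma merge_mulE (F : fieldType) (f : {rmorphism K -> F}) c (X : 'M[F]_(M, c))
    (i : 'I_(M - 1)) (i' z : 'I_M) j : i = i' :> nat -> z = M.-1 :> nat ->
  (map_mx f merge_mx *m X) i j = X i' j + (if i == s :> nat then X z j else 0).
Proof.
move=> Ei Ez; rewrite mxE.
rewrite (eq_bigr (fun r : 'I_M => (r == i')%:R * X r j + ((i == s :> nat) && (r == z))%:R * X r j)).
  rewrite big_split /=; congr (_ + _).
    rewrite (bigD1 i') //= eqxx mul1r big1 ?addr0 // => r /negPf ->; exact: mul0r.
  case: eqP => _ /=; last by rewrite big1 // => r _; rewrite mul0r.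
  rewrite (bigD1 z) //= eqxx mul1r big1 ?addr0 // => r /negPf ->; exact: mul0r.
move=> r _; rewrite !mxE rmorphD !rmorph_nat mulrDl Ei -Ez eq_sym.
by rewrite ![_ == _ :> nat]val_eqE.
Qed.

Lemma last_ord_subproof : (M.-1 < M)%N. Proof. lia. Qed.
Let z := Ordinal last_ord_subproof.

Lemma wid_subproof (i : 'I_(M - 1)) : (i < M)%N. Proof. by have := ltn_ord i; lia. Qed.
Let wid i := Ordinal (wid_subproof i).

Lemma jac_h : jac (M - 1) h = map_mx kL merge_mx *m J.
Proof.
apply/matrixP => i j; rewrite (@merge_mulE _ _ _ _ i (wid i) z) // !jacE /h /=.
case: eqP => [->|_]; last by rewrite addr0.
by rewrite (derivation_pd K n j).1 rmorphD.
Qed.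

(** The kernel of [merge_mx] is the line of [e_(M-1) - e_s] (0-based), and that vector is not an
    apex of [H]; so the matrix is injective on the column space of [J]. *)
Lemma rank_jac_h : \rank (jac (M - 1) h) = (M - 2)%N.
Proof.
rewrite jac_h -mxrank_tr trmx_mul -rkJ -(mxrank_tr J).
rewrite -[RHS](mxrank_mul_ker J^T (map_mx kL merge_mx)^T); apply/eqP.
rewrite -[X in X == _]addn0 eqn_add2l eq_sym mxrank_eq0; apply/rowV0P => v.
rewrite sub_capmx => /andP[/submxP[w Ew] /sub_kermxP vB].
have Bv : map_mx kL merge_mx *m v^T = 0.
  by apply: trmx_inj; rewrite trmx_mul trmxK vB trmx0.
have vi (i : 'I_M) : (i < M.-1)%N -> v 0 i + (if i == s :> nat then v 0 z else 0) = 0.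
  move=> lti; have lti' : (i < M - 1)%N by lia.
  have := merge_mulE kL v^T (i := Ordinal lti') (i' := i) (z := z) 0 erefl erefl.
  by rewrite Bv !mxE /= => <-.
have sM : (s < M)%N by lia.
pose p : 'cV[K]_M := \col_i ((i == z)%:R - (i == s :> nat)%:R).
have pz : p z 0 = 1.
  by rewrite mxE eqxx [_ == s](_ : _ = false) ?subr0 //=; apply/eqP; lia.
have vE : v^T = v 0 z *: map_mx kL p.
  apply/colP => i; rewrite !mxE rmorphB !rmorph_nat.
  have [->|iz] := eqVneq i z.
    by rewrite /= [_ == s](_ : _ = false) ?subr0 ?mulr1 //=; apply/eqP; lia.
  have := vi i; case: eqP => _.
    rewrite sub0r mulrN1 => E; apply/eqP; rewrite -addr_eq0 E //.
    by have := ltn_ord i; move: iz; rewrite -val_eqE /=; lia.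
  rewrite addr0 subr0 mulr0 => -> //.
  by have := ltn_ord i; move: iz; rewrite -val_eqE /=; lia.
have [v0|v0] := eqVneq (v 0 z) 0.
  by apply: trmx_inj; rewrite vE v0 scale0r trmx0.
have /proj_apex_H[_ /(_ z)] : proj_image_apex H p.
  apply/proj_apex_jacP; split.
    by apply/eqP => p0; move: pz; rewrite p0 mxE => /esym/eqP; rewrite oner_eq0.
  exists ((v 0 z)^-1 *: w^T); rewrite -scalemxAr -[jac _ _]trmxK -trmx_mul -Ew vE.
  by rewrite scalerA mulVf ?scale1r.
have le_sz : (s <= z)%N by rewrite /=; lia.
by rewrite pz => /(_ le_sz)/eqP; rewrite oner_eq0.
Qed.

(** The common form of cases (i) and (ii): only zero lies in both gradient spans and is killed by
    every lift [w] of an Euler field. *)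
Hypothesis cap0 : forall W : 'rV[L]_n, (W <= V s k)%MS -> (W <= V l M)%MS ->
  (forall (w : 'cV[L]_n) (al : nat -> K),
     (forall i, (i < M)%N -> dird w (H i) = iota (H i - mconst n (al i))) -> (W *m w) 0 0 = 0) ->
  W = 0.

(* The lift [J w] of an apex [p] of [h] differs from [p] by a multiple [lam] of [e_s - e_(M-1)];
   the relations of the two blocks express [lam] as an element of both of their fields. *)
Lemma lift_last_const (p : 'cV[K]_(M - 1)) (w : 'cV[L]_n) :
  map_mx kL p = map_mx kL merge_mx *m (J *m w) -> exists c, (J *m w) z 0 = kL c.
Proof.
move=> Ep; set lam := (J *m w) z 0; pose P := cvnat p.
have lamE : lam = dird w (H M.-1) by rewrite /lam jac_mulE.
have dE i : (i < M.-1)%N -> dird w (H i) = kL (P i) + (if i == s then - lam else 0).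
  move=> lti; have lti' : (i < M - 1)%N by lia.
  have /colP/(_ (Ordinal lti')) := Ep.
  rewrite (@merge_mulE _ _ _ _ _ (wid (Ordinal lti')) z) // mxE jac_mulE -/lam /= => E.
  rewrite -[P i]/(cvnat p (Ordinal lti')) cvnatE E.
  by case: eqP => _; rewrite ?addrK ?addr0 ?subr0.
(* The index [M.-1] is out of range for [p], where [cvnat] returns 0. *)
have Pz : P M.-1 = 0.
  by rewrite /P /cvnat insubF //; lia.
(* The lift is constant on each block outside one coordinate: the first one here, with [- lam], and
   the last one in [T2], with [lam]. *)
have T1 : tangent (k - s) (fun i => H (s + i)%N) (fun i => kL (P (s + i)%N) + (i == 0%N)%:R * - lam).
  apply/tangent_dird; exists w => i lti; rewrite dE; last lia.
  have -> : (s + i == s)%N = (i == 0)%N by lia.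
  by case: eqP => _; rewrite ?mul1r ?mul0r.
have T2 : tangent (M - l) (fun i => H (l + i)%N)
    (fun i => kL (P (l + i)%N) + (i == (M.-1 - l))%N%:R * lam).
  apply/tangent_dird; exists w => i lti; case: eqP => [->|ne].
    by rewrite subnKC ?Pz ?rmorph0 ?add0r ?mul1r //; lia.
  by rewrite dE ?mul0r; [rewrite (_ : (_ == s) = false) //; lia | lia].
have lt1 : (0 < k - s)%N by lia.
have lt2 : (M.-1 - l < M - l)%N by lia.
have [f [Gf f0]] := noapex_relation (Ordinal lt1) noG1.
have [g [Gg g0]] := noapex_relation (Ordinal lt2) noG2.
have := ratioE lt1 T1 Gf; have := ratioE lt2 T2 Gg.
have sub1 := wronskian_ratio_sub (fun i => H (s + i)%N) (fun i => P (s + i)%N) 0 f.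
have sub2 := wronskian_ratio_sub (fun i => H (l + i)%N) (fun i => P (l + i)%N) (M.-1 - l) g.
have eul := wronskian_ratio_euler lt1 T1 Gf.
set A := ratio_num _ _ f in sub1 eul *; set B := ratio_den _ _ f in sub1 eul *.
set A' := ratio_num _ _ g in sub2 *; set B' := ratio_den _ _ g in sub2 *.
move=> /eqP; rewrite addr_eq0 => /eqP EA' /eqP; rewrite mulNr subr_eq0 => /eqP EA.
(* Both blocks express [lam], so the differential of [A / B] lies in both gradient spans. *)
have W0 : wronskian A B = 0.
  apply: cap0 => //; last first.
    move=> u al Eu; apply: (eul (fun i => al (s + i)%N)) => i lti; apply: Eu; lia.
  have -> : wronskian A B = (iota B' ^+ 2)^-1 *: (iota B' ^+ 2 *: wronskian A B).
    by rewrite scalerA mulVf ?scale1r // expf_neq0 // iota_eq0; apply/eqP.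
  by rewrite (wronskian_opp_ratio EA EA') scalerN -scaleNr scalerA scalemx_sub.
have [c Ec] : exists c, A = mconst n c * B.
  apply: wronskian_proportional => // i lti; apply: iota_inj; apply/eqP.
  by have /rowP/(_ (Ordinal lti)) := W0; rewrite !mxE /= !rmorphM => /eqP; rewrite subr_eq0.
exists c; apply: (mulIf (x := iota B)); first by rewrite iota_eq0; apply/eqP.
by rewrite -EA Ec rmorphM.
Qed.

Lemma merge_pad (q : 'cV[K]_(M - 1)) : (forall i : 'I_(M - 1), (s <= i)%N -> q i 0 = 0) ->
  merge_mx *m (\col_(i < M) cvnat q i) = q.
Proof.
move=> q0; apply/colP => i.
have := merge_mulE idfun (\col_(i < M) cvnat q i) (i := i) (i' := wid i) (z := z) 0 erefl erefl.
rewrite map_mx_id // => ->; rewrite !mxE /= cvnatE.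
have -> : cvnat q M.-1 = 0 by rewrite /cvnat insubF //; lia.
by case: eqP; rewrite addr0.
Qed.

Lemma pad_apex (q : 'cV[K]_(M - 1)) :
  q != 0 -> (forall i : 'I_(M - 1), (s <= i)%N -> q i 0 = 0) ->
  proj_image_apex H (\col_(i < M) cvnat q i).
Proof.
move=> qn0 q0; apply/proj_apex_H; split=> [|i le_si].
  apply: contraNneq qn0 => E; apply/eqP/colP => i.
  by have /colP/(_ (wid i)) := E; rewrite !mxE /= cvnatE.
rewrite mxE /cvnat; case: insubP => //= j _ Ej; apply: q0; by rewrite Ej.
Qed.

(** Once [lam] is a constant [c], the lift of [p] is a constant tangent vector of [H]. By
    [proj_apex_H] its last coordinate [c] vanishes, so [p] is its truncation. The converse pads [p]
    with a zero. *)
Lemma proj_apex_h (p : 'cV[K]_(M - 1)) :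
  proj_image_apex h p <-> (p != 0 /\ forall i : 'I_(M - 1), (s <= i)%N -> p i 0 = 0).
Proof.
split=> [/proj_apex_jacP[p0 [w Ew]]|[p0 Hp]].
  split=> // i le_si; rewrite jac_h -mulmxA in Ew; have [c Ec] := lift_last_const Ew.
  pose q : 'cV[K]_M := \col_j (if (j < M.-1)%N then cvnat p j - (if j == s :> nat then c else 0) else c).
  have Eq : map_mx kL q = J *m w.
    apply/colP => j; rewrite 2!mxE; case: ltnP => [ltj|gej]; last first.
      by rewrite -Ec; congr ((J *m w) _ 0); apply: val_inj => /=; have := ltn_ord j; lia.
    have ltj' : (j < M - 1)%N by lia.
    have /colP/(_ (Ordinal ltj')) := Ew; rewrite (@merge_mulE _ _ _ _ _ j z) // mxE Ec.
    rewrite -[cvnat p j]/(cvnat p (Ordinal ltj')) cvnatE rmorphB => ->.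
    by rewrite /=; case: eqP => _; rewrite ?rmorph0 addrK.
  have q0 (j : 'I_M) : (s <= j)%N -> q j 0 = 0.
    have [->|qn0] := eqVneq q 0; first by rewrite mxE.
    have /proj_apex_H[_ Hq] : proj_image_apex H q by apply/proj_apex_jacP; split=> //; exists w.
    exact: Hq.
  have c0 : c = 0.
    have /q0 : (s <= z)%N by rewrite /=; lia.
    by rewrite mxE ltnn.
  have := q0 (wid i) le_si; rewrite mxE /= cvnatE c0.
  have -> : (i < M.-1)%N by have := ltn_ord i; lia.
  by case: eqP; rewrite subr0.
have /proj_apex_jacP[_ [w Ew]] := pad_apex p0 Hp.
apply/proj_apex_jacP; split=> //; exists w.
by rewrite jac_h -mulmxA -Ew -map_mxM merge_pad.
Qed.

Lemma merge_dB_paired : dB_paired h H merge_mx 1%:M.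
Proof.
split=> [i|]; last first.
  by exists (M - 2)%N; split; apply/is_trdegP => //; apply: rank_jac_h.
rewrite (eq_bigr (fun j : 'I_M => mconst n (merge_mx i j) * H j)); last first.
  move=> j _; congr (_ * _); apply: msubst_mvar => r ltr.
  rewrite (bigD1 (Ordinal ltr)) //= insubT !mxE eqxx rmorph1 mul1r big1 ?addr0 // => r' nr.
  by rewrite mxE eq_sym [_ == _](negPf nr) rmorph0 mul0r.
rewrite (bigD1 (wid i)) //= mxE eqxx /h.
have iM := ltn_ord i; have [E|ne] := eqVneq (nat_of_ord i) s; last first.
  rewrite /= addr0 rmorph1 mul1r big1 ?addr0 // => j; rewrite -val_eqE /= => ji.
  by rewrite mxE eq_sym (negPf ji) (negPf ne) /= addr0 rmorph0 mul0r.
rewrite /= E (_ : (s == M.-1) = false) ?addr0 ?rmorph1 ?mul1r; last by lia.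
rewrite (bigD1 z) /=; last by rewrite -val_eqE /=; lia.
rewrite mxE E !eqxx /= (_ : (s == M.-1) = false) ?add0r ?rmorph1 ?mul1r; last by lia.
rewrite big1 ?addr0 // => j; rewrite -!val_eqE /= E => /andP[js jz].
by rewrite mxE E eq_sym (negPf js) (negPf jz) andbF addr0 rmorph0 mul0r.
Qed.

Lemma main_conclusion :
  (forall p : 'cV[K]_M,
     proj_image_apex H p <-> (p != 0 /\ forall i : 'I_M, (s <= i)%N -> p i 0 = 0)) /\
  (forall p : 'cV[K]_(M - 1),
     proj_image_apex h p <-> (p != 0 /\ forall i : 'I_(M - 1), (s <= i)%N -> p i 0 = 0)) /\
  (exists B : 'M[K]_(M - 1, M),
     dB_paired h H B 1%:M /\
     (forall q : 'cV[K]_(M - 1), proj_image_apex h q ->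
        exists Q : 'cV[K]_M, proj_image_apex H Q /\ q = B *m Q)).
Proof.
split; [exact: proj_apex_H | split; [exact: proj_apex_h |]].
exists merge_mx; split; first exact: merge_dB_paired.
move=> q /proj_apex_h[q0 Hq]; exists (\col_(i < M) cvnat q i).
by rewrite merge_pad //; split=> //; apply: pad_apex.
Qed.

End Main.

(** * Choice of the second block in the two cases *)

Lemma rank_range_add a b c d (H : nat -> mpoly K n) : (a <= b)%N -> (b <= d)%N -> (c <= b)%N ->
  (\rank (jac (d - a) (fun i => H (a + i)%N)) +
   \rank (jac (b - a) (fun i => H (a + i)%N) :&: jac (d - c) (fun i => H (c + i)%N))%MS <=
   \rank (jac (b - a) (fun i => H (a + i)%N)) + \rank (jac (d - c) (fun i => H (c + i)%N)))%N.
Proof.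
move=> ab bd cb; rewrite -[leqRHS]mxrank_sum_cap leq_add2r; apply/mxrankS/range_subP => i /andP[ai id].
have [ib|bi] := ltnP i b.
  by apply: submx_trans (addsmxSl _ _); apply: grad_sub_range; rewrite ai ib.
by apply: submx_trans (addsmxSr _ _); apply: grad_sub_range; rewrite id (leq_trans cb bi).
Qed.

(** An apex of the shorter family, with a zero put in front, would be an apex of [G], since the
    first gradient vanishes. *)
Lemma noapex_drop_const m m' (G G' : nat -> mpoly K n) :
  m' = m.+1 -> (forall i, G' i = G i.+1) -> grad (G 0%N) = 0 ->
  (forall p : 'cV[K]_m', ~ proj_image_apex G p) ->
  forall p : 'cV[K]_m, ~ proj_image_apex G' p.
Proof.
move=> -> GG' g0 noG p /proj_apex_jacP[p0 [w /colP Ew]].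
apply: (noG (\col_i (if i == 0 :> nat then 0 else cvnat p i.-1))); apply/proj_apex_jacP; split.
  apply: contraNneq p0 => /colP E; apply/eqP/colP => i.
  by have := E (lift ord0 i); rewrite !mxE /= cvnatE.
exists w; apply/colP => i; rewrite jac_mulE 2!mxE.
case: (unliftP ord0 i) => [j|] -> /=; last by rewrite !rmorph0 /dird g0 mul0mx mxE.
by have := Ew j; rewrite jac_mulE mxE -cvnatE GG'.
Qed.

(* In case (ii) the second block starts at [k - 1], unless [H (k - 1)] is constant and can be
   dropped. *)
Lemma separating_index M s k (H : nat -> mpoly K n) :
  \rank (jac M H) = (M - 2)%N -> (s < k < M)%N ->
  (forall p : 'cV[K]_(k - s), ~ proj_image_apex (fun i => H (s + i)%N) p) ->
  ((forall p : 'cV[K]_(M - k), ~ proj_image_apex (fun i => H (k + i)%N) p)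
   \/ ((forall p : 'cV[K]_(M - k + 1), ~ proj_image_apex (fun i => H (k.-1 + i)%N) p)
       /\ exists a : 'cV[K]_M, image_apex H a)) ->
  exists l, [/\ (s < l <= k)%N,
    forall p : 'cV[K]_(M - l), ~ proj_image_apex (fun i => H (l + i)%N) p,
    (\rank (jac (M - s) (fun i => H (s + i)%N)) <= M - s - 2)%N &
    forall W : 'rV[L]_n, (W <= jac (k - s) (fun i => H (s + i)%N))%MS ->
      (W <= jac (M - l) (fun i => H (l + i)%N))%MS ->
      (forall (w : 'cV[L]_n) (al : nat -> K),
        (forall i, (i < M)%N -> dird w (H i) = iota (H i - mconst n (al i))) -> (W *m w) 0 0 = 0) ->
      W = 0].
Proof.
move=> rkJ /andP[sk kM] noG1 noG2.
have r1 : (\rank (jac (k - s) (fun i => H (s + i)%N)) < k - s)%N.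
  by apply: noapex_rank noG1; rewrite subn_gt0.
(* The first [s] gradients add at most [s] to the rank of the block from [s] on. *)
have low : (M - 2 <= s + \rank (jac (M - s) (fun i => H (s + i)%N)))%N.
  have := @rank_range_add 0 s s M H (leq0n s) (ltnW (ltn_trans sk kM)) (leqnn s).
  have := rank_leq_row (jac (s - 0) (fun i => H (0 + i)%N)).
  by rewrite /= !subn0 rkJ; lia.
have [noG|[noG apex]] : (forall p : 'cV[K]_(M - k), ~ proj_image_apex (fun i => H (k + i)%N) p) \/
    grad (H k.-1) != 0 /\
    ((forall p : 'cV[K]_(M - k.-1), ~ proj_image_apex (fun i => H (k.-1 + i)%N) p)
       /\ exists a : 'cV[K]_M, image_apex H a).
- case: noG2 => [|[noG apex]]; first by left.
  have [g0|g0] := eqVneq (grad (H k.-1)) 0; [left | right].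
    apply: noapex_drop_const noG; rewrite ?addn1 ?addn0 // => i.
    by rewrite addnS -addSn prednK // (leq_ltn_trans _ sk).
  by split=> //; split=> //; rewrite (_ : (M - k.-1 = M - k + 1)%N) //; lia.
- have r2 : (\rank (jac (M - k) (fun i => H (k + i)%N)) < M - k)%N.
    by apply: noapex_rank noG; rewrite subn_gt0.
  (* The block ranks are at most [k - s - 1] and [M - k - 1], with sum [M - s - 2]; by [low] the
     intersection has rank zero. *)
  have rk := rank_range_add H (ltnW sk) (ltnW kM) (leqnn k).
  exists k; split=> //; [by rewrite sk leqnn | lia |].
  move=> W W1 W2 _; apply/eqP; rewrite -submx0.
  have <- : (jac (k - s) (fun i => H (s + i)%N) :&: jac (M - k) (fun i => H (k + i)%N))%MS = 0.
    by apply/eqP; rewrite -mxrank_eq0; lia.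
  by rewrite sub_capmx W1.
case: apex => noG2' [a Ha]; move: noG => g0.
have gk : (grad (H k.-1) <= jac (k - s) (fun i => H (s + i)%N))%MS by apply: grad_sub_range; lia.
have gl : (grad (H k.-1) <= jac (M - k.-1) (fun i => H (k.-1 + i)%N))%MS by apply: grad_sub_range; lia.
have rg : \rank (grad (H k.-1)) = 1%N by rewrite rank_rV g0.
(* A nonzero gradient gives the first block rank at least 1, and its rank is below [k - s]. *)
have sl : (s < k.-1)%N by have := mxrankS gk; rewrite rg; lia.
have r2 : (\rank (jac (M - k.-1) (fun i => H (k.-1 + i)%N)) < M - k.-1)%N.
  by apply: noapex_rank noG2'; lia.
have rk := rank_range_add H (ltnW sk) (ltnW kM) (leq_pred k).
set X := (_ :&: _)%MS in rk.
have gX : (grad (H k.-1) <= X)%MS by rewrite sub_capmx gk.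
have rX : (1 <= \rank X)%N by have := mxrankS gX; rewrite rg.
exists k.-1; split=> //; [by rewrite sl leq_pred | lia |].
move=> W W1 W2 Weul; have WX : (W <= X)%MS by rewrite sub_capmx W1.
(* The block ranks now add up to at most [M - s - 1], so [low] bounds the rank of [X] by 1, and [X]
   is the line of the gradient of [H k.-1]. *)
have Xg : (X <= grad (H k.-1))%MS by rewrite -(geq_leqif (mxrank_leqif_sup gX)) rg; lia.
have /sub_rVP[c Ec] := submx_trans WX Xg.
have /tangent_dird[w Ew] := image_apex_tangent Ha.
have := Weul w (cvnat a) (fun i lti => esym (Ew i lti)).
rewrite Ec -scalemxAl mxE -[(_ *m _) 0 0]/(dird w (H k.-1)) -Ew; last lia.
(* Either [W] is the zero multiple of that gradient, or [H k.-1] equals the coordinate of [a], hence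
   is constant with zero gradient, against [g0]. *)
move/eqP; rewrite mulf_eq0 => /orP[/eqP ->|]; first by rewrite scale0r.
rewrite iota_eq0 subr_eq0 => /eqP E; move: g0; rewrite E => /negP[]; apply/eqP/rowP => j.
by rewrite !mxE pd_const rmorph0.
Qed.

End Tangent.

(* 0-based indexing: H i is H_{i+1}; the span of e_1..e_s is the set of
   vectors whose coordinates of (0-based) index >= s vanish. *)
Theorem theorem5p2 (K : fieldType) (n M s k : nat) (H : nat -> mpoly K n) :
  [pchar K] =i pred0 ->
  is_trdeg M H (M - 2) ->
  (s < k < M)%N ->
  (forall p : 'cV[K]_(k - s), ~ proj_image_apex (fun i => H (s + i)%N) p) ->
  ((forall p : 'cV[K]_(M - k), ~ proj_image_apex (fun i => H (k + i)%N) p)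
   \/ ((forall p : 'cV[K]_(M - k + 1), ~ proj_image_apex (fun i => H (k.-1 + i)%N) p)
       /\ exists a : 'cV[K]_M, image_apex H a)) ->
  let h : nat -> mpoly K n :=
    fun i => if i == s then H s + H M.-1 else H i in
  (forall p : 'cV[K]_M,
     proj_image_apex H p <-> (p != 0 /\ forall i : 'I_M, (s <= i)%N -> p i 0 = 0)) /\
  (forall p : 'cV[K]_(M - 1),
     proj_image_apex h p <-> (p != 0 /\ forall i : 'I_(M - 1), (s <= i)%N -> p i 0 = 0)) /\
  (exists B : 'M[K]_(M - 1, M),
     dB_paired h H B 1%:M /\
     (forall q : 'cV[K]_(M - 1), proj_image_apex h q ->
        exists Q : 'cV[K]_M, proj_image_apex H Q /\ q = B *m Q)).
Proof.
move=> K0 trH skM noG1 noG2 h.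
have [L [iota inj_iota]] := mpoly_embedding K n.
have rkJ := (is_trdegP inj_iota K0 M H (M - 2)).1 trH.
have [l [/andP[sl lk] noGl rk cap0]] := separating_index inj_iota K0 rkJ skM noG1 noG2.
have /andP[_ kM] := skM.
exact: (main_conclusion inj_iota K0 sl lk kM rkJ noG1 noGl rk cap0).
Qed.
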